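(* In the setting of the context (random unimodal map with heteroscedastic dynamical noise, observed process $Z_n$, observable $\phi$, thresholds $u_n$, sets $B_n=\{\phi>u_n\}$ with diameter tending to $0$), suppose that $$\lim_{n\to\infty}\int\psi\Big(\frac{B_n-x}{s(x)}\Big)dx=0,$$ and that for some $\tau>0$ $$n\Delta_n\to\tau\quad(n\to\infty),\qquad \Delta_n=\int\psi\Big(\frac{B_n-x}{s(x)}\Big)d\mu(x).$$ Suppose moreover that the limits $q_k$ ($k\ge 0$) defining the extremal index $\beta=1-\sum_{k=0}^\infty q_k$ exist and that $\beta>0$. Then $$W_n=\mathfrak P\Big(\max_{0\le j\le n-1}\phi(Z_j)\le u_n\Big)\longrightarrow e^{-\beta\tau},\qquad n\to\infty.$$
   Context: Map and dynamical noise (Assumption TM). $T$ is a continuous unimodal map on $[0,1]$ with a unique maximum at a point $\mathfrak c$, and $\Upsilon:=T(\mathfrak c)<1$; there is a closed interval $[d_1,d_2]\subset[0,1]$, forward invariant under $T$, on which all powers $T^n$, $n\ge1$, are topologically transitive; $T$ preserves a unique absolutely continuous Borel probability measure. Put $\Gamma=1-\Upsilon$, $q=T(0)$ and $I=[-\Gamma,1]$. $T$ is extended to $I$ so that on $[-\Gamma,0]$ it is $C^4$ and decreasing with $T(-\Gamma)<\Upsilon$. $\sigma:\mathbb R\to[0,\infty)$ is differentiable, $\sigma_{\max}=\max_{x\in I}\sigma(x)$, and $a>0$ satisfies $a\le\frac1{\sigma_{\max}}\min\{\frac\Gamma2,\frac q2,\frac12T(1-\frac\Gamma2)\}$. The noises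 $\eta_0,\eta_1,\dots$ are i.i.d. real random variables with density $g(x)=c_a\chi_a(x)e^{-x^2/2}$, where $\chi_a$ is a $C^\infty$ bump function supported in $[-a,a]$ and $c_a$ is the normalizing constant. Set $T_\eta(x)=T(x)+\sigma(x)\eta$ and, for $\underline\eta=(\eta_0,\eta_1,\dots)$, $T^n_{\underline\eta}=T_{\eta_{n-1}}\circ\cdots\circ T_{\eta_0}$, $T^0_{\underline\eta}=\mathrm{id}$. The Markov kernel is $p(x,z)=\frac1{\sigma(x)}g\big(\frac{z-T(x)}{\sigma(x)}\big)$ and the Markov operator is $\mathcal Lf(z)=\int f(x)p(x,z)\,dx$. $\mathcal B$ is the space of functions of bounded variation on $I$ with norm $\|f\|_{\mathcal B}=\mathrm{Var}(f)+\|f\|_{L^1}$. Standing facts of the setting: random orbits stay in $[-\Gamma/2,1-\Gamma/2]$; there is a unique absolutely continuous stationary probability measure $\mu$, with density $h$ ($\mathcal Lh=h$) supported in $I_\Gamma=[\frac12T(1-\frac\Gamma2),1-\frac\Gamma2]$; $\operatorname{ess\,sup}_x\mathrm{Var}(p(x,\cdot))<\infty$, so $\mathcal L$ is compact on $\mathcal B$; $1$ is a simple eigenvalue of $\mathcal L$ and $\mathcal L$ has a spectral gap. Observational noise. $s:I\to I$ is strictly positive and Lipschitz; $(\epsilon_k)_{k\ge0}$ are i.i.d. with values in $[-1,1]$ and law $\psi$, independent of the $\eta_k$ and of the initial point; $\sup_{x\in I,\epsilon\in[-1,1]}|s(x)\epsilon|<\Gamma/2$. $\mathfrak P$ is the product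 of $\mu$ (law of the initial point $x$), the law of $\underline\eta$ and the law of $(\epsilon_k)$. The observed process is $Z_n=T^n_{\underline\eta}(x)+s(T^n_{\underline\eta}(x))\epsilon_n$. Notation: $\psi\big(\frac{B-x}{s(x)}\big)=\psi(\{\epsilon: x+s(x)\epsilon\in B\})$. Extremes. $\phi:I\to\mathbb R\cup\{\pm\infty\}$ is measurable, $(u_n)$ is a real sequence, $B_n=\{\phi>u_n\}$, and the diameter of $B_n$ tends to $0$ as $n\to\infty$ (Assumption B). It is also required that $h$ is bounded below by a positive constant (independent of $n$) on the set $\{x: x+s(x)\epsilon\in B_n\text{ for some }\epsilon\in\mathrm{supp}\,\psi\}$. The perturbed operator is $$\hat{\mathcal L}_nf=\mathcal L\Big(f(\cdot)\int\mathbf 1_{B_n^c}(\cdot+s(\cdot)\epsilon)\,d\psi(\epsilon)\Big),$$ and $$q_k=\lim_{n\to\infty}\frac{\int(\mathcal L-\hat{\mathcal L}_n)\hat{\mathcal L}_n^k(\mathcal L-\hat{\mathcal L}_n)(h)\,dx}{\Delta_n}.$$ *)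

(* Defs.v *)
From HB Require Import structures.
From mathcomp Require Export all_boot all_order all_algebra.
From mathcomp Require Export all_classical all_reals all_analysis.
From mathcomp Require Export measurable_realfun ess_sup_inf.
Set Implicit Arguments.
Unset Strict Implicit.
Unset Printing Implicit Defensive.
Export Order.TTheory GRing.Theory Num.Theory.
Export numFieldNormedType.Exports.

Local Open Scope classical_set_scope.
Local Open Scope ring_scope.

(* Functions on the interval I are represented by total functions R -> R (or
   R -> \bar R). Their values outside I are irrelevant; T, s and phi are only
   required to be Borel on the whole line, so that the set of sample points
   where the observed maximum stays below a threshold is an event. *)

Section general_notions.
Context {R : realType}.
Implicit Types (a b : R) (f : R -> R) (A : set R).

Definition diameter A : R := sup [set `|x.1 - x.2| | x in A `*` A].

Definition msupport (m : set R -> \bar R) : set R :=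
  [set x | forall U : set R, open U -> U x -> (0 < m U)%E].

(* Existence of an extension to the line is the convention used here for
   one-sided smoothness at the endpoints. *)
Definition Ck_on (k : nat) a b f : Prop :=
  exists F : R -> R,
    [/\ {in `[a, b], F =1 f},
        (forall j, (j < k)%N -> forall x, derivable (derive1n j F) x 1) &
        continuous (derive1n k F)].

Definition smooth f : Prop := forall (n : nat) (x : R), derivable (derive1n n f) x 1.

Definition topologically_transitive (D : set R) f : Prop :=
  forall U V : set R, open U -> open V -> D `&` U !=set0 -> D `&` V !=set0 ->
  exists k : nat, exists2 x, (D `&` U) x & V (iter k f x).

Definition acim01 f (nu : probability (measurableTypeR R) R) : Prop :=
  [/\ nu `[0, 1]%classic = 1%E,
      nu `<< lebesgue_measure &
      forall A, measurable A -> nu (`[0, 1]%classic `&` f @^-1` A) = nu A].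

End general_notions.

(* The Banach space of functions of bounded variation on [a, b]: functions are
   taken pointwise on [a, b], and Var is the pointwise total variation. *)
Section bv_space.
Context {R : realType}.
Variables a b : R.
Implicit Types (f g : R -> R) (L : (R -> R) -> R -> R).

Definition eq_on f g : Prop := {in `[a, b], f =1 g}.

Definition bv_norm f : R :=
  fine (total_variation a b f) + \int[lebesgue_measure]_(x in `[a, b]) `|f x|.

Definition bv_stable L : Prop :=
  forall f, bounded_variation a b f -> bounded_variation a b (L f).

Definition bv_linear L : Prop :=
  forall (c : R) f g, bounded_variation a b f -> bounded_variation a b g ->
  eq_on (L (fun x => c * f x + g x)) (fun x => c * L f x + L g x).

Definition bv_bounded L : Prop :=
  exists K : R, forall f, bounded_variation a b f ->
  bv_norm (L f) <= K * bv_norm f.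

Definition bv_compact L : Prop :=
  bv_stable L /\
  forall f_ : nat -> R -> R,
    (forall n, bounded_variation a b (f_ n)) ->
    (exists K : R, forall n, bv_norm (f_ n) <= K) ->
  exists (e : nat -> nat) (g : R -> R),
    [/\ {homo e : m n / (m < n)%N}, bounded_variation a b g &
        (fun n => bv_norm (L (f_ (e n)) \- g)) @ \oo --> (0 : R)].

(* Algebraic simplicity: the generalized eigenspace is a line. *)
Definition bv_simple_eigenvalue L (lam : R) : Prop :=
  exists e : R -> R,
    [/\ bounded_variation a b e, ~ eq_on e (fun=> 0),
        eq_on (L e) (fun x => lam * e x) &
        forall (k : nat) f, bounded_variation a b f ->
          eq_on (iter k (fun g x => L g x - lam * g x) f) (fun=> 0) ->
          exists c : R, eq_on f (fun x => c * e x)].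

(* L = Pi + Q with Pi a rank-one projection, L Pi = Pi L = Pi (equivalently
   L Pi = Pi and Pi Q = Q Pi = 0), and Q of spectral radius < 1. *)
Definition bv_spectral_gap L : Prop :=
  exists Pi : (R -> R) -> R -> R,
    [/\ [/\ bv_stable Pi, bv_linear Pi & bv_bounded Pi],
        (exists e : R -> R,
          [/\ bounded_variation a b e, ~ eq_on e (fun=> 0), eq_on (Pi e) e &
              forall f, bounded_variation a b f ->
                exists c : R, eq_on (Pi f) (fun x => c * e x)]),
        (forall f, bounded_variation a b f ->
          eq_on (L (Pi f)) (Pi f) /\ eq_on (Pi (L f)) (Pi f)) &
        exists C rho : R, [/\ 0 <= rho, rho < 1 &
          forall (n : nat) f, bounded_variation a b f ->
            bv_norm (iter n (fun g => L g \- Pi g) f)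
              <= C * rho ^+ n * bv_norm f]].

End bv_space.

Record noisy_map (R : realType) := NoisyMap {
  tmap : R -> R;      (* T *)
  tpeak : R;          (* location of the maximum of T *)
  core_left : R;      (* d_1 *)
  core_right : R;     (* d_2 *)
  sigma : R -> R;
  amp : R;            (* a *)
  bump : R -> R       (* chi_a *)
}.

Section dynamical_noise.
Context {R : realType}.
Variable M : noisy_map R.
Local Notation T := (tmap M).
Local Notation leb := (@lebesgue_measure R).

Definition Upsilon : R := T (tpeak M).
Definition Gamma : R := 1 - Upsilon.
Definition phase : set R := `[- Gamma, 1]%classic.
Definition sigma_max : R := sup (sigma M @` phase).
Definition core : set R := `[core_left M, core_right M]%classic.

Record assumption_TM : Prop := AssumptionTM {
  tmap_measurable : measurable_fun [set: R] T;
  tmap_unit : {in `[0, 1], forall x, T x \in `[0, 1]};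
  tmap_continuous : {within `[0, 1]%classic, continuous T};
  tpeak_inside : 0 < tpeak M < 1;
  tmap_increasing : {in `[0, tpeak M] &, {homo T : x y / x < y}};
  tmap_decreasing : {in `[tpeak M, 1] &, {homo T : x y /~ x < y}};
  Upsilon_lt1 : Upsilon < 1;
  core_itv : [/\ 0 <= core_left M, core_left M < core_right M &
                 core_right M <= 1];
  core_invariant : T @` core `<=` core;
  core_transitive : forall n, (0 < n)%N ->
    topologically_transitive core (iter n T);
  tmap_acim : exists nu, acim01 T nu /\
    forall nu', acim01 T nu' ->
      forall A : set R, measurable A -> nu' A = nu A;
  ext_C4 : Ck_on 4 (- Gamma) 0 T;
  ext_decreasing : {in `[- Gamma, 0] &, {homo T : x y /~ x < y}};
  ext_left : T (- Gamma) < Upsilon;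
  sigma_ge0 : forall x, 0 <= sigma M x;
  sigma_derivable : forall x, derivable (sigma M) x 1;
  amp_gt0 : 0 < amp M;
  amp_le : amp M <= sigma_max^-1 *
    Num.min (Gamma / 2) (Num.min (T 0 / 2) (T (1 - Gamma / 2) / 2));
  bump_smooth : smooth (bump M);
  bump_ge0 : forall x, 0 <= bump M x;
  bump_neq0 : exists x, bump M x != 0;
  bump_supp : forall x, amp M < `|x| -> bump M x = 0
}.

Definition noise_const : R :=
  (\int[leb]_x (bump M x * expR (- (x ^+ 2 / 2))))^-1.

(* g *)
Definition noise_density (x : R) : R :=
  noise_const * bump M x * expR (- (x ^+ 2 / 2)).

Definition noise_law (E : set R) : \bar R :=
  (\int[leb]_(x in E) (noise_density x)%:E)%E.

Definition tmap_noisy (e x : R) : R := T x + sigma M x * e.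

Fixpoint random_orbit (e : nat -> R) (n : nat) (x : R) : R :=
  if n is m.+1 then tmap_noisy (e m) (random_orbit e m x) else x.

(* p(x, z) *)
Definition trans_density (x z : R) : R :=
  (sigma M x)^-1 * noise_density ((z - T x) / sigma M x).

(* L *)
Definition markov (f : R -> R) (z : R) : R :=
  \int[leb]_(x in phase) (f x * trans_density x z).

Definition stationary (nu : probability (measurableTypeR R) R) : Prop :=
  nu phase = 1%E /\
  forall A : set R, measurable A ->
    (\int[nu]_(x in phase) noise_law [set e | A (tmap_noisy e x)])%E = nu A.

Record standing_facts (mu : probability (measurableTypeR R) R) (h : R -> R)
    : Prop := StandingFacts {
  mu_stationary : stationary mu;
  mu_unique : forall nu : probability (measurableTypeR R) R,
    stationary nu -> nu `<< leb ->
    forall A : set R, measurable A -> nu A = mu A;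
  h_measurable : measurable_fun [set: R] h;
  h_ge0 : forall x, 0 <= h x;
  mu_density : forall A : set R, measurable A ->
    mu A = (\int[leb]_(x in A) (h x)%:E)%E;
  (* L h is a smooth function, so the version h = L h of the density, which is
     the one selected here, is determined at every point of I. *)
  h_fixed : forall z, phase z -> markov h z = h z;
  h_supp : forall x, x \notin `[T (1 - Gamma / 2) / 2, 1 - Gamma / 2] -> h x = 0;
  kernel_var : (ess_sup leb
    ((fun x => total_variation (- Gamma) 1 (trans_density x)) \_ phase) < +oo)%E;
  markov_compact : bv_compact (- Gamma) 1 markov;
  markov_simple : bv_simple_eigenvalue (- Gamma) 1 markov 1;
  markov_gap : bv_spectral_gap (- Gamma) 1 markov
}.

End dynamical_noise.

Section observational_noise.
Context {R : realType}.
Variables (M : noisy_map R) (s : R -> R).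
Variable psi : probability (measurableTypeR R) R.
Local Notation I := (phase M).
Local Notation leb := (@lebesgue_measure R).

Record observational_noise : Prop := ObservationalNoise {
  s_measurable : measurable_fun [set: R] s;
  s_phase : forall x, I x -> I (s x);
  s_gt0 : forall x, I x -> 0 < s x;
  s_lipschitz : [lipschitz s x | x in I];
  psi_itv : psi `[-1, 1]%classic = 1%E;
  s_small :
    sup [set `|s z.1 * z.2| | z in I `*` `[-1, 1]%classic] < Gamma M / 2
}.

(* psi ((B - x) / s(x)) *)
Definition hit (B : set R) (x : R) : R := fine (psi [set e | B (x + s x * e)]).

(* The complement of B is taken in the line: x + s(x) e may leave I when x is
   close to the boundary of I. *)
Definition markov_hat (B : set R) (f : R -> R) : R -> R :=
  markov M (fun x => f x * \int[psi]_e (\1_(~` B) (x + s x * e))).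

Definition markov_diff (B : set R) (f : R -> R) (z : R) : R :=
  markov M f z - markov_hat B f z.

Definition Delta (mu : probability (measurableTypeR R) R) (B : set R) : R :=
  \int[mu]_(x in I) hit B x.

Definition return_ratio (mu : probability (measurableTypeR R) R) (h : R -> R)
    (B : set R) (k : nat) : R :=
  (\int[leb]_(z in I)
     markov_diff B (iter k (markov_hat B) (markov_diff B h)) z) / Delta mu B.

Definition exceedance (phi : R -> \bar R) (u : nat -> R) (n : nat) : set R :=
  [set x | I x /\ ((u n)%:E < phi x)%E].

Definition q_coef (mu : probability (measurableTypeR R) R) (h : R -> R)
    (B : nat -> set R) (k : nat) : R :=
  limn (fun n => return_ratio mu h (B n) k).

Definition extremal_index (mu : probability (measurableTypeR R) R)
    (h : R -> R) (B : nat -> set R) : R :=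
  1 - limn (series (q_coef mu h B)).

End observational_noise.

Section probability_space.
Context {R : realType} {d : measure_display} {Omega : measurableType d}.
Variables (P : probability Omega R) (M : noisy_map R) (s : R -> R).
Variables (X : {RV P >-> R}).
Variables (eta eps : nat -> {RV P >-> R}).

(* The joint law of (X, eta, eps) is the product measure
   mu (x) noise_law^(x)N (x) psi^(x)N, given by its values on cylinders. *)
Definition product_law (mu psi : probability (measurableTypeR R) R) : Prop :=
  forall (N : nat) (A : set R) (E F : nat -> set R),
    measurable A -> (forall k, measurable (E k)) ->
    (forall k, measurable (F k)) ->
  P [set w | A (X w) /\
             forall k, (k < N)%N -> E k (eta k w) /\ F k (eps k w)] =
  (mu A * \prod_(k < N) (noise_law M (E k) * psi (F k)))%E.

Definition observed (n : nat) (w : Omega) : R :=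
  let y := random_orbit M (fun k => eta k w) n (X w) in y + s y * eps n w.

Definition max_below (phi : R -> \bar R) (u : nat -> R) (n : nat) : set Omega :=
  [set w | (\big[maxe/-oo]_(j < n) phi (observed j w) <= (u n)%:E)%E].

End probability_space.

(* Main.v *)
Require Import Defs.
From HB Require Import structures.
From mathcomp Require Import ring lra.
Set Implicit Arguments.
Unset Strict Implicit.
Unset Printing Implicit Defensive.
Local Open Scope classical_set_scope.
Local Open Scope ring_scope.

(** Write [L] for the Markov operator, [k] for the probability that an orbit at
    [x] is observed in [B n], [H f = L (f (1 - k))] for the perturbed operator
    and [D f = L (f k)], so that [L = H + D]. Independence of the noises gives
    [W_n = J (H^n h)], where [J] is the integral over the phase space
    ([no_hit_probability], [max_below_probability]). Everything then rests on
    the masses [a_m = J (H^m h)] and the densities [f_m = H^m h].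

    The variation of the kernel is bounded by some [V] for almost every starting
    point, hence so is the kernel itself, and [|L f| <= V J |f|] everywhere.
    This smoothing replaces the usual perturbation theory of the leading
    eigenvalue. First, [f_(m+1) <= V a_m], and since little mass is killed in
    one step the normalised densities [f_m / a_m] stay bounded uniformly in [m]
    and in large [n] ([survival_half]). Second, [h] is at least [c] wherever [k]
    is positive, so a function bounded by [S] loses at most [S Delta_n / c] to a
    kill; hence [H^l] and [L^l] differ by [O(l Delta_n)] on bounded functions,
    and the spectral gap of [L] makes [H^l] small on functions of zero integral
    ([killed_decay]).

    Splitting [f_m = a_m h + r] with [J r = 0] gives
    [a_(m+l) - a_(m+l+1) = J (k H^l f_m) = a_m J (k H^l h) + o(Delta_n a_m)].
    By stationarity, [h = H h + D h], so [J (k H^l h)] is exactly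
    [Delta_n (1 - q_0 - ... - q_(l-1))] with the return ratios at level [n]
    ([kill_expansion], [survival_renewal]). Letting [n] and then [l] tend to
    infinity, each step multiplies the mass by [1 - Delta_n (beta + o(1))],
    uniformly in [m], and [n Delta_n] tends to [tau] ([exponential_law]).

    The spectral gap is used only through the decay of [L^n r] when [J r = 0]:
    one application of [L] makes [r] a function of bounded variation, and the
    spectral projection, whose range is spanned by [h], sends it to a multiple
    of [h] with zero integral ([spectral_decay]). *)

(** * A sequence losing almost constant proportions *)

Section exponential_law.
Context {R : realType}.

Lemma expR_le1B (x : R) : x < 1 -> expR (- (x / (1 - x))) <= 1 - x.
Proof.
move=> x1; have x1' : 0 < 1 - x by lra.
rewrite expRN -[leRHS]invrK lef_pV2 ?posrE ?expR_gt0 ?invr_gt0//.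
apply: le_trans (expR_ge1Dx _).
suff -> : 1 + x / (1 - x) = (1 - x)^-1 by [].
by field; lra.
Qed.

(** In one step the sequence loses [(beta + O(e)) D n] times its value [l]
    steps before, and over [l] steps it changes by a factor [1 + O(D n)]. So
    from time [l] on every step is a multiplication by
    [1 - (beta + O(e)) D n], and [n] of them give the exponential. *)
Lemma exponential_law (a : nat -> nat -> R) (D : nat -> R) (beta tau K : R) :
  0 < beta -> (forall n, 0 <= D n) ->
  (fun n => n%:R * D n) @ \oo --> tau ->
  (forall n, a n 0%N = 1) ->
  (forall n m, 0 <= a n m.+1 <= a n m) ->
  (\forall n \near \oo, forall m, a n m - a n m.+1 <= K * D n * a n m) ->
  (forall e : R, 0 < e -> exists l, \forall n \near \oo, forall m,
     `|a n (m + l)%N - a n (m + l).+1 - beta * D n * a n m|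
       <= e * D n * a n m) ->
  (fun n => a n n) @ \oo --> expR (- (beta * tau)).
Proof.
move=> beta0 D0 Dtau a0 amono aK abeta.
have age0 n m : 0 <= a n m.
  by case: m => [|m]; [rewrite a0|have /andP[] := amono n m].
have adec n m k : a n (m + k)%N <= a n m.
  elim: k => [|k ih]; first by rewrite addn0.
  by rewrite addnS; apply: le_trans ih; have /andP[] := amono n (m + k)%N.
have Dcvg0 : D @ \oo --> (0 : R).
  have : (fun n => n.+1%:R^-1 * (n.+1%:R * D n.+1)) @ \oo --> 0 * tau.
    apply: cvgM; first exact: cvg_harmonic.
    by rewrite (cvg_shiftS (fun n => n%:R * D n)).
  rewrite mul0r => Dn; rewrite -(cvg_shiftS D).
  apply: cvg_trans Dn; apply: near_eq_cvg; apply: nearW => n.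
  by rewrite mulrA mulVf ?pnatr_eq0// mul1r.
have expcvg (f : nat -> R) l : f @ \oo --> l -> (expR \o f) @ \oo --> expR l.
  by move=> fl; apply: continuous_cvg => //; exact: continuous_expR.
(* One-sided bounds with an error [e], which is sent to 0 at the end. *)
have upper (e : R) : 0 < e < beta -> forall c, expR (- ((beta - e) * tau)) < c ->
    \forall n \near \oo, a n n < c.
  move=> /andP[e0 eb] c ec; have [l al] := abeta e e0.
  have lim : (fun n => expR (- ((beta - e) * (n%:R * D n - l%:R * D n)))) @ \oo
      --> expR (- ((beta - e) * tau)).
    apply: (expcvg (fun n => - ((beta - e) * (n%:R * D n - l%:R * D n)))).
    apply: cvgN; apply: cvgM; first exact: cvg_cst.
    rewrite -[X in _ --> X]subr0; apply: cvgB => //.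
    by rewrite -[X in _ --> X](mulr0 l%:R); apply: cvgM => //; exact: cvg_cst.
  have step : \forall n \near \oo, forall m,
      a n (m + l).+1 <= expR (- ((beta - e) * D n)) * a n (m + l)%N.
    near=> n => m.
    have /(_ m) : forall m, `|a n (m + l)%N - a n (m + l).+1 -
        beta * D n * a n m| <= e * D n * a n m by near: n.
    rewrite ler_norml => /andP[H1 _].
    have H2 : 1 - (beta - e) * D n <= expR (- ((beta - e) * D n)).
      by apply: le_trans (expR_ge1Dx _); rewrite lexx.
    apply: le_trans (ler_wpM2r (age0 _ _) H2).
    have H3 : (beta - e) * D n * a n (m + l)%N <= (beta - e) * D n * a n m.
      by apply: ler_wpM2l; [rewrite mulr_ge0// subr_ge0 ltW|exact: adec].
    lra.
  have /cvgr_lt /(_ _ ec) H := lim.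
  near=> n.
  have ln : (l <= n)%N by near: n; exact: nbhs_infty_ge.
  have st : forall m,
      a n (m + l).+1 <= expR (- ((beta - e) * D n)) * a n (m + l)%N.
    by near: n.
  rewrite -[X in a n X](subnK ln).
  apply: (@le_lt_trans _ _ (expR (- ((beta - e) * D n)) ^+ (n - l)%N)); last first.
    rewrite -expRM_natl.
    rewrite (_ : _ *  _ = - ((beta - e) * (n%:R * D n - l%:R * D n))); last first.
      by rewrite natrB//; ring.
    by near: n.
  elim: (n - l)%N => [|k ih].
    by rewrite expr0 -(a0 n) add0n; exact: (adec n 0%N l).
  rewrite addSn exprS; apply: le_trans (st k) _.
  by apply: ler_wpM2l; rewrite ?expR_ge0.
have lower (e : R) : 0 < e -> forall c, c < expR (- ((beta + e) * tau)) ->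
    \forall n \near \oo, c < a n n.
  move=> e0 c ec; have [l al] := abeta e e0.
  pose dl n := (1 - K * D n) ^+ l.
  pose x n := (beta + e) * D n / dl n.
  have KD0 : (fun n => K * D n) @ \oo --> (0 : R).
    by rewrite -[X in _ --> X](mulr0 K); apply: cvgM => //; exact: cvg_cst.
  have dl1 : dl @ \oo --> (1 : R).
    rewrite -[X in _ --> X](expr1n R l).
    apply: (@cvg_comp _ _ _ (fun n => 1 - K * D n) (fun y : R => y ^+ l)).
      by apply: cvgB KD0; exact: cvg_cst.
    by rewrite subr0; exact: exprn_continuous.
  have dlV : (fun n => (dl n)^-1) @ \oo --> (1 : R).
    by rewrite -[X in _ --> X]invr1; apply: cvgV => //; exact: oner_neq0.
  have x0 : x @ \oo --> (0 : R).
    rewrite (_ : 0 = (beta + e) * 0 * 1); last by rewrite mulr0 mul0r.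
    by apply: cvgM => //; apply: cvgM => //; exact: cvg_cst.
  have lim : (fun n => dl n * expR (- ((beta + e) * (n%:R * D n) * (dl n)^-1 *
      (1 - x n)^-1))) @ \oo --> expR (- ((beta + e) * tau)).
    rewrite -[X in _ --> X]mul1r; apply: cvgM => //.
    apply: (expcvg (fun n => - ((beta + e) * (n%:R * D n) * (dl n)^-1 *
      (1 - x n)^-1))).
    apply: cvgN; rewrite -[X in _ --> X]mulr1.
    apply: cvgM.
      rewrite -[X in _ --> X]mulr1; apply: cvgM => //.
      by apply: cvgM => //; exact: cvg_cst.
    rewrite -[X in _ --> X]invr1; apply: cvgV; first exact: oner_neq0.
    by rewrite -[X in _ --> X](subr0 1); apply: cvgB => //; exact: cvg_cst.
  have /cvgr_gt /(_ _ ec) H := lim.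
  near=> n.
  have ln : (l <= n)%N by near: n; exact: nbhs_infty_ge.
  have KDn : K * D n < 1 by near: n; move/cvgr_lt : KD0; apply; exact: ltr01.
  have dl0 : 0 < dl n by apply: exprn_gt0; lra.
  have xn1 : x n < 1 by near: n; move/cvgr_lt : x0; apply; exact: ltr01.
  have xn0 : 0 <= x n by rewrite /x divr_ge0 ?(ltW dl0)// mulr_ge0//; lra.
  have aKn : forall m, a n m - a n m.+1 <= K * D n * a n m by near: n.
  have aln : forall m, `|a n (m + l)%N - a n (m + l).+1 - beta * D n * a n m|
       <= e * D n * a n m by near: n.
  have back m k : (1 - K * D n) ^+ k * a n m <= a n (m + k)%N.
    elim: k => [|k ih]; first by rewrite expr0 mul1r addn0.
    rewrite exprS -mulrA addnS; have := aKn (m + k)%N => ?.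
    have : (1 - K * D n) * ((1 - K * D n) ^+ k * a n m) <=
      (1 - K * D n) * a n (m + k)%N by apply: ler_wpM2l => //; lra.
    lra.
  have st m : (1 - x n) * a n (m + l)%N <= a n (m + l).+1.
    have := aln m; rewrite ler_norml => /andP[_ h2].
    have h3 : a n m <= (dl n)^-1 * a n (m + l)%N.
      by rewrite ler_pdivlMl//; exact: back.
    have h4 : (beta + e) * D n * a n m <= x n * a n (m + l)%N.
      rewrite /x -[leRHS]mulrA; apply: ler_wpM2l => //.
      by rewrite mulr_ge0//; lra.
    lra.
  apply: (@lt_le_trans _ _ (dl n * (1 - x n) ^+ n)).
    apply: (@lt_le_trans _ _ (dl n * expR (- ((beta + e) * (n%:R * D n) * (dl n)^-1 *
      (1 - x n)^-1)))); first by near: n.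
    apply: ler_wpM2l; first exact: ltW.
    rewrite (_ : - _ = n%:R * - (x n / (1 - x n))); last by rewrite /x; ring.
    rewrite expRM_natl; apply: lerXn2r; rewrite ?nnegrE ?expR_ge0//; first lra.
    exact: expR_le1B.
  apply: (@le_trans _ _ (dl n * (1 - x n) ^+ (n - l))).
    apply: ler_wpM2l; first exact: ltW.
    apply: ler_wiXn2l; [lra|lra|exact: leq_subr].
  rewrite -[X in a n X](subnK ln).
  elim: (n - l)%N => [|k ih].
    by rewrite expr0 mulr1 add0n; have := back 0%N l; rewrite a0 mulr1 add0n.
  rewrite addSn exprS mulrCA; apply: le_trans (st k).
  by apply: ler_wpM2l => //; lra.
have contE : forall s : R, (fun e => expR (- ((beta + s * e) * tau))) @ (0 : R)^'+
    --> expR (- (beta * tau)).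
  move=> s; apply: cvg_at_right_filter.
  apply: (@cvg_comp _ _ _ (fun e : R => - ((beta + s * e) * tau)) expR); last first.
    exact: continuous_expR.
  rewrite [X in _ `=>` X](_ : _ = nbhs (- ((beta + s * 0) * tau))); last first.
    by rewrite mulr0 addr0.
  apply: cvgN; apply: cvgM; last exact: cvg_cst.
  apply: cvgD; first exact: cvg_cst.
  by apply: cvgM; [exact: cvg_cst|exact: cvg_id].
apply/cvgrPdist_lt => eps eps0.
near (0 : R)^'+ => e.
have e0 : 0 < e by [].
have eb : e < beta by near: e; exact: nbhs_right_lt.
have h1 : expR (- ((beta + (-1) * e) * tau)) < expR (- (beta * tau)) + eps.
  by near: e; move/cvgr_lt : (contE (-1)); apply; lra.
have h2 : expR (- (beta * tau)) - eps < expR (- ((beta + 1 * e) * tau)).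
  by near: e; move/cvgr_gt : (contE 1); apply; lra.
rewrite mulN1r in h1; rewrite mul1r in h2.
have ebb : 0 < e < beta by rewrite e0 eb.
have := upper _ ebb _ h1.
have := lower _ e0 _ h2.
apply: filterS2 => n lo up.
by rewrite ltr_norml; apply/andP; split; lra.
Unshelve. all: by end_near. Qed.

End exponential_law.

(** * Integrals of bounded functions and killed mixing operators *)

Section bounded_functions.
Context d (T : measurableType d) (R : realType).
Variables (mu : {measure set T -> \bar R}) (I : set T).
Hypotheses (mI : measurable I) (finI : (mu I < +oo)%E).
Implicit Types f g k : T -> R.

(** Integrals are over [I], so the values outside [I] need not be bounded. *)
Definition bounded_measurable f :=
  measurable_fun [set: T] f /\ exists A, forall x, I x -> `|f x| <= A.

Local Notation good := bounded_measurable.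
Local Notation J := (Rintegral mu I).

Lemma bm_integrable f : good f -> mu.-integrable I (EFin \o f).
Proof.
move=> [mf [A fA]]; apply: measurable_bounded_integrable => //.
  exact: measurable_funS mf.
exists (Num.max A 0); split; first by rewrite num_real.
move=> y Ay x Ix; apply: (le_trans (fA x Ix)).
by rewrite ltW// (le_lt_trans _ Ay)// le_max lexx.
Qed.

Lemma bm_cst (r : R) : good (fun=> r).
Proof. by split; [exact: measurable_cst|exists `|r|]. Qed.

Lemma bmD f g : good f -> good g -> good (fun x => f x + g x).
Proof.
move=> [mf [A fA]] [mg [B gB]]; split; first exact: measurable_funD.
exists (A + B) => x Ix; apply: le_trans (ler_normD _ _) _.
by apply: lerD; [exact: fA|exact: gB].
Qed.

Lemma bmM f g : good f -> good g -> good (fun x => f x * g x).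
Proof.
move=> [mf [A fA]] [mg [B gB]]; split; first exact: measurable_funM.
by exists (A * B) => x Ix; rewrite normrM; apply: ler_pM; rewrite ?fA ?gB.
Qed.

Lemma bmZ (r : R) f : good f -> good (fun x => r * f x).
Proof. by move=> gf; apply: bmM => //; exact: bm_cst. Qed.

Lemma bmB f g : good f -> good g -> good (fun x => f x - g x).
Proof.
move=> gf gg; rewrite (_ : (fun _ => _) = fun x => f x + (-1) * g x).
  by apply: bmD => //; exact: bmZ.
by apply/funext => x; rewrite mulN1r.
Qed.

Lemma bm_norm f : good f -> good (fun x => `|f x|).
Proof.
move=> [mf [A fA]]; split; first exact: measurableT_comp.
by exists A => x Ix; rewrite normr_id fA.
Qed.

Lemma bm_int_le f g : good f -> good g -> (forall x, I x -> f x <= g x) ->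
  J f <= J g.
Proof. by move=> gf gg; apply: le_Rintegral => //; exact: bm_integrable. Qed.

Lemma bm_intD f g : good f -> good g -> J (fun x => f x + g x) = J f + J g.
Proof. by move=> gf gg; rewrite RintegralD//; exact: bm_integrable. Qed.

Lemma bm_intB f g : good f -> good g -> J (fun x => f x - g x) = J f - J g.
Proof. by move=> gf gg; rewrite RintegralB//; exact: bm_integrable. Qed.

Lemma bm_intZ (r : R) f : good f -> J (fun x => r * f x) = r * J f.
Proof. by move=> gf; rewrite RintegralZl//; exact: bm_integrable. Qed.

Lemma bm_int_norm f : good f -> `|J f| <= J (fun x => `|f x|).
Proof. by move=> gf; apply: le_normr_Rintegral => //; exact: bm_integrable. Qed.

End bounded_functions.

Section killed_operator.
Context d (T : measurableType d) (R : realType).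
Variables (mu : {measure set T -> \bar R}) (I : set T).
Hypotheses (mI : measurable I) (finI : (mu I < +oo)%E).
Implicit Types (f g k h : T -> R) (L : (T -> R) -> T -> R) (V C rho c : R).

Local Notation good := (bounded_measurable I).
Local Notation J := (Rintegral mu I).

(** What is needed of a transfer operator. The field [mix_sup] is the smoothing
    by an absolutely continuous noise of bounded density; [mix_decay] is the
    spectral gap, seen on functions of zero integral only: of the two additional
    iterations, the first makes a bounded function regular and the last turns
    an integral bound into a uniform one. *)
Record mixing_operator L h V C rho : Prop := MixingOperator {
  mix_bm : forall f, good f -> good (L f);
  mix_linear : forall r f g, good f -> good g ->
    L (fun x => r * f x + g x) = (fun x => r * L f x + L g x);
  mix_ge0 : forall f x, (forall y, I y -> 0 <= f y) -> 0 <= L f x;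
  mix_sup : forall f x, good f -> `|L f x| <= V * J (fun y => `|f y|);
  mix_int : forall f, good f -> J (L f) = J f;
  mix_fixed_bm : good h;
  mix_fixed_ge0 : forall x, 0 <= h x;
  mix_fixed_int : J h = 1;
  mix_fixed : L h = h;
  mix_sup_ge0 : 0 <= V;
  mix_decay_ge0 : 0 <= C /\ 0 <= rho;
  mix_decay : forall n f x, good f -> J f = 0 ->
    `|iter n.+2 L f x| <= C * rho ^+ n * J (fun y => `|f y|)
}.

(** Each unit of mass at [x] is removed with probability [k x] before it is
    transported by [L]. *)
Definition killed L k f := L (fun x => f x * (1 - k x)).

Variables (L : (T -> R) -> T -> R) (h k : T -> R) (V C rho c : R).
Hypothesis mixL : mixing_operator L h V C rho.
Hypothesis k_meas : measurable_fun [set: T] k.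
Hypothesis k01 : forall x, 0 <= k x <= 1.
Hypothesis c0 : 0 < c.
Hypothesis kh : forall x, I x -> k x * c <= k x * h x.

Local Notation H := (killed L k).
Local Notation D := (fun f => L (fun x => f x * k x)).
Local Notation f_ m := (iter m H h).
Local Notation a m := (J (iter m H h)).
Local Notation Dl := (J (fun x => h x * k x)).

Let gh : good h := mix_fixed_bm mixL.

Let k0 x : 0 <= k x. Proof. by have /andP[] := k01 x. Qed.
Let k1 x : k x <= 1. Proof. by have /andP[] := k01 x. Qed.

Lemma bm_kill : good k.
Proof. by split=> //; exists 1 => x _; rewrite ger0_norm. Qed.
Let gk : good k := bm_kill.

Let g1k : good (fun x => 1 - k x).
Proof. by apply: bmB => //; exact: bm_cst. Qed.

Lemma bm_killed f : good f -> good (H f).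
Proof. by move=> gf; apply: (mix_bm mixL); exact: bmM. Qed.

Lemma bm_iter_killed n f : good f -> good (iter n H f).
Proof. by move=> gf; elim: n => //= n; exact: bm_killed. Qed.

Lemma bm_iter n f : good f -> good (iter n L f).
Proof. by move=> gf; elim: n => //= n; exact: (mix_bm mixL). Qed.

Lemma mix_add f g : good f -> good g ->
  L (fun x => f x + g x) = (fun x => L f x + L g x).
Proof.
move=> gf gg; rewrite -[RHS]/(fun x => L f x + L g x).
have := mix_linear mixL 1 gf gg.
rewrite (_ : (fun x => 1 * f x + g x) = fun x => f x + g x); last first.
  by apply/funext => x; rewrite mul1r.
by move=> ->; apply/funext => x; rewrite mul1r.
Qed.

Lemma mix_scale r f : good f -> L (fun x => r * f x) = (fun x => r * L f x).
Proof.
move=> gf; have g0 := bm_cst I (0 : R).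
have := mix_linear mixL r gf g0.
have -> : L (fun=> 0) = fun=> 0.
  have := mix_linear mixL (-1) g0 g0.
  rewrite (_ : (fun=> -1 * 0 + 0) = fun=> 0); last first.
    by apply/funext => x; rewrite mulr0 addr0.
  by move=> {1}->; apply/funext => x; rewrite mulN1r addNr.
rewrite (_ : (fun x => r * f x + 0) = fun x => r * f x); last first.
  by apply/funext => x; rewrite addr0.
by move=> ->; apply/funext => x; rewrite addr0.
Qed.

Lemma mix_sub f g : good f -> good g ->
  L (fun x => f x - g x) = (fun x => L f x - L g x).
Proof.
move=> gf gg; have gg' := bmZ (-1) gg.
rewrite (_ : (fun x => f x - g x) = fun x => f x + (-1) * g x); last first.
  by apply/funext => x; rewrite mulN1r.
by rewrite mix_add// mix_scale//; apply/funext => x; rewrite mulN1r.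
Qed.

Lemma mix_norm f x : good f -> `|L f x| <= L (fun y => `|f y|) x.
Proof.
move=> gf; have gn := bm_norm gf.
rewrite ler_norml; apply/andP; split.
  rewrite -subr_ge0 opprK; have := mix_add gf gn.
  move=> /(congr1 (fun u => u x)) <-; apply: (mix_ge0 mixL) => y _.
  by have := ler_norm (- f y); rewrite normrN; lra.
rewrite -subr_ge0; have := mix_sub gn gf.
move=> /(congr1 (fun u => u x)) <-; apply: (mix_ge0 mixL) => y _.
by rewrite subr_ge0 ler_norm.
Qed.

Lemma mix_int_norm f : good f ->
  J (fun x => `|L f x|) <= J (fun x => `|f x|).
Proof.
move=> gf; rewrite -(mix_int mixL (bm_norm gf)).
apply: bm_int_le => //; first by apply: bm_norm; exact: (mix_bm mixL).
  by apply: (mix_bm mixL); exact: bm_norm.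
by move=> x _; exact: mix_norm.
Qed.

Lemma killed_linear r f g : good f -> good g ->
  H (fun x => r * f x + g x) = (fun x => r * H f x + H g x).
Proof.
move=> gf gg; rewrite /killed.
rewrite -(mix_linear mixL r (bmM gf g1k) (bmM gg g1k)).
by congr (L _); apply/funext => x; rewrite mulrDl mulrA.
Qed.

Lemma iter_killed_linear n r f g : good f -> good g ->
  iter n H (fun x => r * f x + g x) =
  (fun x => r * iter n H f x + iter n H g x).
Proof.
move=> gf gg; elim: n => //= n ->.
by rewrite killed_linear//; exact: bm_iter_killed.
Qed.

Lemma killed_split f : good f -> L f = (fun x => H f x + D f x).
Proof.
move=> gf; rewrite /killed -mix_add//; try exact: bmM.
by congr (L _); apply/funext => x; rewrite mulrBr mulr1 subrK.
Qed.

Lemma killed_int f : good f -> J (H f) = J f - J (fun x => f x * k x).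
Proof.
move=> gf; rewrite /killed (mix_int mixL); last exact: bmM.
rewrite -bm_intB//; last exact: bmM.
by congr (J _); apply/funext => x; rewrite mulrBr mulr1.
Qed.

Lemma killed_norm_le f x : `|f x * (1 - k x)| <= `|f x|.
Proof.
have := k0 x; have := k1 x => k1x k0x.
by rewrite normrM -[leRHS]mulr1; apply: ler_wpM2l => //; rewrite ger0_norm; lra.
Qed.

Lemma killed_sup f x : good f -> `|H f x| <= V * J (fun y => `|f y|).
Proof.
move=> gf; apply: le_trans (mix_sup mixL _ _) _; first exact: bmM.
apply: ler_wpM2l; first exact: (mix_sup_ge0 mixL).
apply: bm_int_le => //; try (by apply: bm_norm => //; exact: bmM).
by move=> y _; exact: killed_norm_le.
Qed.

Lemma killed_int_norm f : good f ->
  J (fun x => `|H f x|) <= J (fun x => `|f x|).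
Proof.
move=> gf; apply: le_trans (mix_int_norm (bmM gf g1k)) _.
apply: bm_int_le => //; try (by apply: bm_norm => //; exact: bmM).
by move=> y _; exact: killed_norm_le.
Qed.

Lemma killed_ge0 f : (forall x, I x -> 0 <= f x) -> forall x, 0 <= H f x.
Proof.
move=> f0 x; apply: (mix_ge0 mixL) => y Iy; apply: mulr_ge0; first exact: f0.
by have /andP[_ ?] := k01 y; rewrite subr_ge0.
Qed.

Lemma iter_killed_ge0 n f : (forall x, 0 <= f x) ->
  forall x, 0 <= iter n H f x.
Proof. by move=> f0; elim: n => //= n ih; apply: killed_ge0 => x _. Qed.

Lemma int_kill_ge0 : 0 <= Dl.
Proof.
apply: Rintegral_ge0 => x _; apply: mulr_ge0; first exact: (mix_fixed_ge0 mixL).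
by have /andP[] := k01 x.
Qed.

(** The lower bound of [h] where [k] lives turns integrals of [k] for the
    reference measure into integrals for the stationary one. *)
Lemma int_kill_le : J k <= Dl / c.
Proof.
rewrite ler_pdivlMr// mulrC -bm_intZ//; apply: bm_int_le => //.
- exact: bmZ.
- exact: bmM.
- by move=> x Ix; rewrite mulrC [leRHS]mulrC; exact: kh.
Qed.

(** A density bounded by [S] loses at most this mass to one kill. *)
Lemma int_kill_sup f S : good f -> 0 <= S -> (forall x, I x -> f x <= S) ->
  J (fun x => f x * k x) <= S * (Dl / c).
Proof.
move=> gf S0 fS; apply: (@le_trans _ _ (S * J k)); last first.
  by apply: ler_wpM2l => //; exact: int_kill_le.
rewrite -bm_intZ//; apply: bm_int_le => //.
- exact: bmM.
- exact: bmZ.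
- by move=> x Ix; apply: ler_wpM2r; [exact: k0|exact: fS].
Qed.

Lemma survival0 : a 0 = 1.
Proof. exact: (mix_fixed_int mixL). Qed.

Lemma survivalS m : a m - a m.+1 = J (fun x => f_ m x * k x).
Proof. by rewrite /= killed_int ?subKr//; exact: bm_iter_killed. Qed.

Lemma survival_ge0 m : 0 <= a m.
Proof.
apply: Rintegral_ge0 => x _; apply: iter_killed_ge0; exact: (mix_fixed_ge0 mixL).
Qed.

Lemma survival_le m : a m.+1 <= a m.
Proof.
rewrite -subr_ge0 survivalS; apply: Rintegral_ge0 => x _; apply: mulr_ge0.
  by apply: iter_killed_ge0; exact: (mix_fixed_ge0 mixL).
exact: k0.
Qed.

Let gf m : good (f_ m). Proof. exact: bm_iter_killed. Qed.
Let f0 m x : 0 <= f_ m x.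
Proof. by apply: iter_killed_ge0; exact: (mix_fixed_ge0 mixL). Qed.
Let V0 : 0 <= V := mix_sup_ge0 mixL.

Let norm_f m : (fun x => `|f_ m x|) = f_ m.
Proof. by apply/funext => x; rewrite ger0_norm. Qed.

Lemma mix_fixed_le x : h x <= V.
Proof.
have := mix_sup mixL x gh; rewrite (mix_fixed mixL).
have -> : (fun y => `|h y|) = h := norm_f 0.
by rewrite (mix_fixed_int mixL) mulr1 ger0_norm// (mix_fixed_ge0 mixL).
Qed.

Hypothesis small : 4 * V * Dl <= c.

(** By smoothing, the next density is at most [V] times the present mass. The
    next kill therefore removes at most half of the mass, and the bound can be
    restated with the next mass: the normalised densities stay bounded for
    ever. *)
Lemma survival_half m : a m <= 2 * a m.+1 /\
  (forall x, f_ m x <= 2 * V * a m).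
Proof.
have e0 : 0 <= Dl / c by rewrite divr_ge0 ?int_kill_ge0 ?ltW.
have sm : V * (Dl / c) <= 4^-1 by rewrite mulrA ler_pdivrMr// ler_pdivlMl// mulrA.
have step n : (forall x, f_ n x <= 2 * V * a n) -> a n <= 2 * a n.+1.
  move=> fn; have := survivalS n.
  have : J (fun x => f_ n x * k x) <= (2 * V * a n) * (Dl / c).
    apply: int_kill_sup => //.
      by apply: mulr_ge0; [exact: mulr_ge0|exact: survival_ge0].
  have : V * (Dl / c) * a n <= 4^-1 * a n.
    by apply: ler_wpM2r => //; exact: survival_ge0.
  lra.
suff fm : forall x, f_ m x <= 2 * V * a m by split => //; exact: step.
elim: m => [|m ih] x.
  rewrite survival0 mulr1 /=; have := mix_fixed_le x; have := V0; lra.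
have -> : f_ m.+1 x = `|H (f_ m) x| by rewrite ger0_norm//; exact: (f0 m.+1).
apply: le_trans (killed_sup _ (gf m)) _; rewrite norm_f.
by apply: le_trans (ler_wpM2l V0 (step _ ih)) _; rewrite mulrA [V * 2]mulrC.
Qed.

Lemma survival_drop m : a m - a m.+1 <= 2 * V / c * Dl * a m.
Proof.
rewrite survivalS.
rewrite (_ : _ * a m = 2 * V * a m * (Dl / c)); last by ring.
apply: int_kill_sup => //.
  by apply: mulr_ge0; [exact: mulr_ge0|exact: survival_ge0].
by move=> x _; exact: (survival_half m).2.
Qed.

Lemma return_int j :
  J (D (iter j H (D h))) = J (fun x => iter j H (D h) x * k x).
Proof.
apply: (mix_int mixL); apply: bmM => //; apply: bm_iter_killed.
by apply: (mix_bm mixL); exact: bmM.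
Qed.

Lemma return_ge0 j : 0 <= J (D (iter j H (D h))).
Proof.
rewrite return_int; apply: Rintegral_ge0 => x _; apply: mulr_ge0.
  apply: iter_killed_ge0 => y; apply: (mix_ge0 mixL) => z _.
  by apply: mulr_ge0; [exact: (mix_fixed_ge0 mixL)|exact: k0].
exact: k0.
Qed.

(** Stationarity reads [h = H h + D h], hence [H^(l+1) h = H^l h - H^l (D h)]:
    the mass killed after [l] free steps is the mass of a single kill, less, for
    each [j < l], that of two kills separated by exactly [j] free steps. *)
Lemma kill_expansion l : J (fun x => f_ l x * k x) =
  Dl - \sum_(0 <= j < l) J (D (iter j H (D h))).
Proof.
elim: l => [|l ih]; first by rewrite big_geq// subr0.
have gDh : good (D h) by apply: (mix_bm mixL); exact: bmM.
rewrite big_nat_recr//= opprD addrA -ih return_int.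
rewrite -bm_intB//; try (by apply: bmM => //; exact: bm_iter_killed).
congr (J _); apply/funext => x; rewrite -mulrBl; congr (_ * _).
suff {2}-> : h = (fun x => 1 * H h x + D h x).
  rewrite iter_killed_linear//; last exact: bm_killed.
  by rewrite mul1r addrK -iterSr.
apply/funext => y; rewrite mul1r.
by rewrite -[LHS](congr1 (fun u => u y) (mix_fixed mixL)) (killed_split gh).
Qed.

Lemma return_sum_le l : \sum_(0 <= j < l) J (D (iter j H (D h))) <= Dl.
Proof.
rewrite -subr_ge0 -kill_expansion; apply: Rintegral_ge0 => x _.
by apply: mulr_ge0 => //; exact: k0.
Qed.

(** The iterates of [H] and [L] on [r] drift apart by one kill per step, and
    each kill costs at most [S * (Dl / c)] in mean, then in sup norm by
    smoothing. So the decay of the iterates of [L] passes to those of [H]. *)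
Lemma killed_decay n r S : good r -> J r = 0 -> 0 <= S ->
  (forall x, I x -> `|r x| <= S) -> (V * J (fun x => `|r x|) <= S) ->
  forall x, `|iter n.+2 H r x| <=
    C * rho ^+ n * J (fun y => `|r y|) + V * (n.+2%:R * (S * (Dl / c))).
Proof.
move=> gr r0 S0 rS JrS.
have gu i : good (iter i H r) by exact: bm_iter_killed.
have gL i : good (iter i L r) by exact: bm_iter.
have Ju i : J (fun x => `|iter i H r x|) <= J (fun x => `|r x|).
  by elim: i => //= i; apply: le_trans; exact: killed_int_norm.
have uS i x : I x -> `|iter i H r x| <= S.
  case: i => [|i] Ix /=; first exact: rS.
  apply: le_trans (killed_sup _ (gu i)) _; apply: le_trans JrS.
  by apply: ler_wpM2l.
pose e i := fun x => iter i H r x - iter i L r x.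
have ge i : good (e i) by exact: bmB.
have eS i : e i.+1 = L (fun x => e i x - iter i H r x * k x).
  rewrite /e /= /killed -mix_sub//; last exact: bmM.
  congr (L _); apply/funext => x; ring.
have gek i : good (fun x => e i x - iter i H r x * k x).
  by apply: bmB => //; exact: bmM.
have Je i : J (fun x => `|e i x - iter i H r x * k x|) <=
    J (fun x => `|e i x|) + S * (Dl / c).
  apply: (@le_trans _ _ (J (fun x => `|e i x| + `|iter i H r x| * k x))).
    apply: bm_int_le => //.
    - exact: bm_norm.
    - by apply: bmD; [exact: bm_norm|apply: bmM => //; exact: bm_norm].
    - move=> x _; apply: le_trans (ler_normB _ _) _.
      by rewrite normrM [`|k x|]ger0_norm//; exact: k0.
  rewrite bm_intD//; [|exact: bm_norm|by apply: bmM => //; exact: bm_norm].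
  by rewrite lerD2l; apply: int_kill_sup => //; [exact: bm_norm|exact: uS].
have Jee i : J (fun x => `|e i x|) <= i%:R * (S * (Dl / c)).
  elim: i => [|i ih].
    rewrite mul0r /e /=.
    under [X in J X]eq_fun do rewrite subrr normr0.
    by rewrite Rintegral_cst// mul0r.
  rewrite eS; apply: le_trans (mix_int_norm (gek i)) _.
  by apply: le_trans (Je i) _; rewrite -natr1 mulrDl mul1r lerD2r.
move=> x; have -> : iter n.+2 H r x = iter n.+2 L r x + e n.+2 x.
  by rewrite /e addrC subrK.
apply: le_trans (ler_normD _ _) _; apply: lerD.
  exact: (mix_decay mixL).
rewrite eS; apply: le_trans (mix_sup mixL _ (gek _)) _.
apply: ler_wpM2l => //; apply: le_trans (Je _) _.
by rewrite -[n.+2%:R]natr1 mulrDl mul1r lerD2r.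
Qed.

(** The density after [m] steps is [a m] times [h] plus a remainder of zero
    integral. The first part contributes the exact expansion of
    [kill_expansion]; the second has decayed after [l.+2] further steps. *)
Lemma survival_renewal m l :
  `|a (m + l.+2)%N - a (m + l.+2).+1 -
     (Dl - \sum_(0 <= j < l.+2) J (D (iter j H (D h)))) * a m| <=
  (2 * C * rho ^+ l + V * (l.+2%:R * (3 * V * (Dl / c)))) / c * Dl * a m.
Proof.
have am0 := survival_ge0 m.
pose r x := f_ m x - a m * h x.
have gr : good r by apply: bmB => //; exact: bmZ.
have r0 : J r = 0.
  by rewrite /r bm_intB ?bm_intZ ?(mix_fixed_int mixL) ?mulr1 ?subrr//; exact: bmZ.
have h0 := mix_fixed_ge0 mixL.
have Jr : J (fun x => `|r x|) <= 2 * a m.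
  apply: (@le_trans _ _ (J (fun x => f_ m x + a m * h x))).
    apply: bm_int_le => //; first exact: bm_norm.
      by apply: bmD => //; exact: bmZ.
    move=> x _; apply: le_trans (ler_normB _ _) _.
    by rewrite !ger0_norm// mulr_ge0.
  rewrite bm_intD// ?bm_intZ ?(mix_fixed_int mixL)//; last exact: bmZ.
  by rewrite mulr1; lra.
have S0 : 0 <= 3 * V * a m by rewrite !mulr_ge0.
have rS x : I x -> `|r x| <= 3 * V * a m.
  move=> _; apply: le_trans (ler_normB _ _) _.
  rewrite [`|f_ m x|]ger0_norm// [`|a m * h x|]ger0_norm; last exact: mulr_ge0.
  have := (survival_half m).2 x.
  by have := ler_wpM2l am0 (mix_fixed_le x); lra.
have JrS : V * J (fun x => `|r x|) <= 3 * V * a m.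
  by apply: (le_trans (ler_wpM2l V0 Jr)); have := mulr_ge0 V0 am0; lra.
have dec := killed_decay l gr r0 S0 rS JrS.
have -> : a (m + l.+2)%N - a (m + l.+2).+1 =
    a m * J (fun x => f_ l.+2 x * k x) + J (fun x => iter l.+2 H r x * k x).
  rewrite survivalS -bm_intZ//; last by apply: bmM.
  rewrite -bm_intD//; last 2 first.
  - by apply: bmZ; exact: bmM.
  - by apply: bmM => //; exact: bm_iter_killed.
  congr (J _); apply/funext => x; rewrite mulrA -mulrDl; congr (_ * _).
  rewrite addnC iterD.
  have := iter_killed_linear l.+2 (a m) gh gr.
  move=> /(congr1 (fun u => u x)) <-; congr (iter _ _ _ x).
  by apply/funext => y; rewrite /r addrC subrK.
rewrite kill_expansion mulrC addrAC subrr add0r.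
have gir : good (iter l.+2 H r) by exact: bm_iter_killed.
apply: le_trans (bm_int_norm _ _ (bmM gir gk)) _ => //.
set B := (X in X / c).
have B0 : 0 <= C * rho ^+ l * J (fun y : T => `|r y|) +
    V * (l.+2%:R * (3 * V * a m * (Dl / c))).
  have [[x _]|] := pselect (exists x : T, True); first exact: le_trans (dec x).
  move=> nT; have JE u : J u = 0.
    rewrite (_ : u = fun=> 0) ?Rintegral_cst ?mul0r//.
    by apply/funext => x; exfalso; apply: nT; exists x.
  by rewrite !JE mul0r !mulr0 addr0.
apply: (@le_trans _ _ ((C * rho ^+ l * J (fun y : T => `|r y|) +
    V * (l.+2%:R * (3 * V * a m * (Dl / c)))) * (Dl / c))).
  rewrite (_ : (fun x => `|_|) = fun x => `|iter l.+2 H r x| * k x).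
    by apply: int_kill_sup => //; exact: bm_norm.
  by apply/funext => x; rewrite normrM [`|k x|]ger0_norm//; exact: k0.
rewrite (_ : B / c * Dl * a m = B * a m * (Dl / c)); last by rewrite /B; ring.
apply: ler_wpM2r; first by rewrite divr_ge0 ?int_kill_ge0 ?ltW.
rewrite (_ : B * a m = C * rho ^+ l * (2 * a m) +
    V * (l.+2%:R * (3 * V * a m * (Dl / c)))); last by rewrite /B; ring.
rewrite lerD2r.
have [C0 rho0] := mix_decay_ge0 mixL.
have : 0 <= C * rho ^+ l by rewrite mulr_ge0// exprn_ge0.
by move=> /ler_wpM2l; apply.
Qed.

End killed_operator.

(** * The exponential law for killed mixing operators *)

Section killed_limit.
Context d (T : measurableType d) (R : realType).
Variables (mu : {measure set T -> \bar R}) (I : set T).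
Hypotheses (mI : measurable I) (finI : (mu I < +oo)%E).
Local Notation J := (Rintegral mu I).
Variables (L : (T -> R) -> T -> R) (h : T -> R) (V C rho c tau : R).
Variable k : nat -> T -> R.
Hypothesis mixL : mixing_operator mu I L h V C rho.
Hypothesis rho1 : rho < 1.
Hypothesis k_meas : forall n, measurable_fun [set: T] (k n).
Hypothesis k01 : forall n x, 0 <= k n x <= 1.
Hypothesis c0 : 0 < c.
Hypothesis kh : forall n x, I x -> k n x * c <= k n x * h x.

(** This is [Delta_n]; the ratios with limits [q_j] are the quotients of the
    return masses by it. *)
Definition kill_mass n := J (fun x => h x * k n x).

Definition return_mass n j :=
  let D f := L (fun x => f x * k n x) in
  J (D (iter j (killed L (k n)) (D h))).

Hypothesis tau0 : 0 < tau.
Hypothesis cvg_tau : (fun n => n%:R * kill_mass n) @ \oo --> tau.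
Hypothesis cvg_ret : forall j, cvgn (fun n => return_mass n j / kill_mass n).

Let q j := limn (fun n => return_mass n j / kill_mass n).

Let mass_ge0 n : 0 <= kill_mass n.
Proof. exact: (int_kill_ge0 mixL). Qed.

Let mass_gt0 : \forall n \near \oo, 0 < kill_mass n.
Proof.
move/cvgr_gt : cvg_tau => /(_ _ tau0); apply: filterS => n.
by rewrite lt0r mass_ge0 andbT; case: eqP => // ->; rewrite mulr0 ltxx.
Qed.

Let mass_cvg0 : kill_mass @ \oo --> (0 : R).
Proof.
have : (fun n => n.+1%:R^-1 * (n.+1%:R * kill_mass n.+1)) @ \oo --> 0 * tau.
  apply: cvgM; first exact: cvg_harmonic.
  by rewrite (cvg_shiftS (fun n => n%:R * kill_mass n)).
rewrite mul0r => Dn; rewrite -(cvg_shiftS kill_mass).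
apply: cvg_trans Dn; apply: near_eq_cvg; apply: nearW => n.
by rewrite mulrA mulVf ?pnatr_eq0// mul1r.
Qed.

Let ratio_ge0 n j : 0 <= return_mass n j / kill_mass n.
Proof. by rewrite divr_ge0//; apply: (return_ge0 mixL). Qed.

Let series_ratio l : (fun n => \sum_(0 <= j < l) (return_mass n j / kill_mass n))
  @ \oo --> series q l.
Proof.
elim: l => [|l ih].
  rewrite /series/= big_geq//; under eq_fun do rewrite big_geq//.
  exact: cvg_cst.
rewrite seriesSr; under eq_fun do rewrite big_nat_recr//=.
by apply: cvgD => //; exact: cvg_ret.
Qed.

(** The partial sums are nondecreasing, and bounded by 1 because the
    mass killed after [l] free steps cannot be negative. *)
Lemma return_series_cvg : cvgn (series q).
Proof.
apply: nondecreasing_is_cvgn.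
  apply/nondecreasing_seqP => l; rewrite seriesSr lerDl.
  by apply: limr_ge; [exact: cvg_ret|exact: nearW].
exists 1 => _ [l _ <-].
rewrite -(cvg_lim (@Rhausdorff R) (@series_ratio l)); apply: limr_le.
  by apply/cvg_ex; eexists; exact: series_ratio.
near=> n; have D0 : 0 < kill_mass n by near: n.
rewrite -mulr_suml ler_pdivrMr// mul1r.
exact: (return_sum_le mI finI mixL).
Unshelve. all: by end_near. Qed.

Lemma killed_exponential_law : 0 < 1 - limn (series q) ->
  (fun n => J (iter n (killed L (k n)) h)) @ \oo
    --> expR (- ((1 - limn (series q)) * tau)).
Proof.
set beta := 1 - _ => beta0.
have [C0 rho0] := mix_decay_ge0 mixL.
have V0 := mix_sup_ge0 mixL.
have small : \forall n \near \oo, 4 * V * kill_mass n <= c.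
  near=> n; apply: ltW; near: n.
  have : (fun n => 4 * V * kill_mass n) @ \oo --> 4 * V * 0.
    by apply: cvgM => //; exact: cvg_cst.
  by rewrite mulr0 => /cvgr_lt; apply.
apply: (@exponential_law _ (fun n m => J (iter m (killed L (k n)) h)) kill_mass
  beta tau (2 * V / c)) => //.
- by move=> n; exact: (mix_fixed_int mixL).
- move=> n m; rewrite (survival_ge0 mixL (k01 n))/=.
  exact: (survival_le mI finI mixL (@k_meas n) (k01 n)).
- near=> n => m; apply: (survival_drop mI finI mixL (@k_meas n) (k01 n) c0) => //.
    exact: kh.
  by near: n.
move=> e e0.
have e4 : 0 < e / 4 by rewrite divr_gt0.
have ser : \forall l \near \oo, `|limn (series q) - series q l.+2| < e / 4.
  have : (fun l => series q l.+2) @ \oo --> limn (series q).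
    have := return_series_cvg; rewrite -(cvg_shiftn 2).
    by under eq_fun do rewrite addn2.
  by move/cvgrPdist_lt => /(_ _ e4).
have geo : \forall l \near \oo, 2 * C * rho ^+ l / c < e / 4.
  have : (fun l => 2 * C * rho ^+ l / c) @ \oo --> 2 * C * 0 / c.
    apply: cvgM; last exact: cvg_cst.
    apply: cvgM; first exact: cvg_cst.
    by apply: cvg_expr; rewrite ger0_norm.
  by rewrite mulr0 mul0r => /cvgr_lt; apply.
(* The order of the limits matters: first [l], then [n] depending on [l]. *)
near \oo => l.
have serl : `|limn (series q) - series q l.+2| < e / 4 by near: l.
have geol : 2 * C * rho ^+ l / c < e / 4 by near: l.
exists l.+2.
have fin1 : \forall n \near \oo, `|series q l.+2 -
    \sum_(0 <= j < l.+2) (return_mass n j / kill_mass n)| < e / 4.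
  by move: (@series_ratio l.+2) => /cvgrPdist_lt /(_ _ e4).
have fin2 : \forall n \near \oo,
    V * (l.+2%:R * (3 * V * (kill_mass n / c))) / c < e / 4.
  have : (fun n => V * (l.+2%:R * (3 * V * (kill_mass n / c))) / c) @ \oo -->
      V * (l.+2%:R * (3 * V * (0 / c))) / c.
    apply: cvgM; last exact: cvg_cst.
    apply: cvgM; first exact: cvg_cst.
    apply: cvgM; first exact: cvg_cst.
    apply: cvgM; first exact: cvg_cst.
    by apply: cvgM => //; exact: cvg_cst.
  by rewrite mul0r !mulr0 mul0r => /cvgr_lt; apply.
near=> n => m.
have D0 : 0 < kill_mass n by near: n.
have sm : 4 * V * kill_mass n <= c by near: n.
have f1 : `|series q l.+2 -
    \sum_(0 <= j < l.+2) (return_mass n j / kill_mass n)| < e / 4 by near: n.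
have f2 : V * (l.+2%:R * (3 * V * (kill_mass n / c))) / c < e / 4 by near: n.
have := survival_renewal mI finI mixL (@k_meas n) (k01 n) c0 (@kh n) sm m l.
have am0 : 0 <= J (iter m (killed L (k n)) h) := survival_ge0 mixL (k01 n) m.
set a := J (iter m _ _) in am0 *; set b := J (iter _ _ _); set b' := J (iter _ _ _).
rewrite -/(kill_mass n) -/(return_mass n _).
under eq_bigr do rewrite -/(return_mass n _).
set S := \sum_(0 <= j < l.+2) _ => H.
move: f1; rewrite -mulr_suml -/S => f1.
have Da : 0 <= kill_mass n * a by rewrite mulr_ge0.
have H2 : `|(kill_mass n - S) * a - beta * kill_mass n * a| <=
    e / 2 * (kill_mass n * a).
  rewrite (_ : _ - _ = (limn (series q) - S / kill_mass n) * (kill_mass n * a)).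
    rewrite normrM (ger0_norm Da); apply: ler_wpM2r => //.
    rewrite (_ : _ - _ = limn (series q) - series q l.+2 +
      (series q l.+2 - S / kill_mass n)); last by ring.
    by apply: le_trans (ler_normD _ _) _; lra.
  by rewrite /beta; field; rewrite gt_eqF.
rewrite (_ : b - b' - _ = (b - b' - (kill_mass n - S) * a) +
  ((kill_mass n - S) * a - beta * kill_mass n * a)); last by ring.
apply: le_trans (ler_normD _ _) _; apply: le_trans (lerD H H2) _.
rewrite [leRHS](_ : _ = e / 2 * (kill_mass n * a) + e / 2 * (kill_mass n * a));
  last by field.
rewrite lerD2r -[leLHS]mulrA; apply: ler_wpM2r => //.
by rewrite mulrDl; move: geol f2; lra.
Unshelve. all: by end_near. Qed.

End killed_limit.

(** * Densities, affine images of Lebesgue measure, and joint laws *)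

Section density.
Local Open Scope ereal_scope.
Import HBNNSimple.
Context d (T : measurableType d) (R : realType).
Variables (mu nu : {measure set T -> \bar R}) (g : T -> R).
Hypotheses (mg : measurable_fun [set: T] g) (g0 : forall x, (0 <= g x)%R).
Hypothesis nuE : forall A, measurable A -> nu A = \int[mu]_(x in A) (g x)%:E.

Lemma ge0_integral_density (f : T -> \bar R) : measurable_fun [set: T] f ->
  (forall x, 0 <= f x) -> \int[nu]_x f x = \int[mu]_x (f x * (g x)%:E).
Proof.
move=> mf f0; pose f_ := nnsfun_approx measurableT mf.
have mfg n : measurable_fun [set: T] (fun x => (f_ n x)%:E * (g x)%:E).
  by apply: emeasurable_funM; exact/measurable_EFinP.
transitivity (limn (fun n => \int[nu]_x (f_ n x)%:E)).
  rewrite -monotone_convergence//=.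
  - apply: eq_integral => x _; apply/esym/cvg_lim => //=.
    exact: cvg_nnsfun_approx.
  - by move=> n; exact/measurable_EFinP.
  - by move=> n x _; rewrite lee_fin.
  - by move=> x _ m n mn; rewrite lee_fin; exact/lefP/nd_nnsfun_approx.
transitivity (limn (fun n => \int[mu]_x ((f_ n x)%:E * (g x)%:E))); last first.
  rewrite -monotone_convergence//=.
  - apply: eq_integral => x _; apply/cvg_lim => //=.
    apply: cvgeZr => //.
    exact: cvg_nnsfun_approx.
  - by move=> n x _; rewrite mule_ge0// lee_fin.
  - move=> x _ m n mn; apply: lee_wpmul2r; first by rewrite lee_fin.
    by rewrite lee_fin; exact/lefP/nd_nnsfun_approx.
congr (limn _); apply/funext => n.
transitivity (\sum_(r \in range (f_ n)) r%:E * nu (f_ n @^-1` [set r])).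
  by rewrite integralT_nnsfun sintegralE.
transitivity (\int[mu]_x \sum_(r \in range (f_ n))
    (r%:E * (\1_(f_ n @^-1` [set r]) x * g x)%:E)); last first.
  apply: eq_integral => x _; rewrite [f_ n x]fimfunE -fsumEFin//.
  rewrite ge0_mule_fsuml; last first.
    by move=> r; rewrite EFinM nnfun_muleindic_ge0.
  by apply: eq_fsbigr => r _; rewrite !EFinM muleA.
rewrite ge0_integral_fsum//; last 2 first.
- move=> r; apply: measurable_funeM; apply/measurable_EFinP.
  exact: measurable_funM.
- move=> r x _; rewrite EFinM muleA; apply: mule_ge0; last by rewrite lee_fin.
  by rewrite nnfun_muleindic_ge0.
apply: eq_fsbigr => r; rewrite inE => -[x0 _ <-].
rewrite ge0_integralZl//; last 3 first.
- by apply/measurable_EFinP; exact: measurable_funM.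
- by move=> x _; rewrite lee_fin mulr_ge0.
- by rewrite lee_fin.
congr (_ * _); rewrite nuE// integral_mkcond; apply: eq_integral => x _.
rewrite patchE indicE; case: ifPn => xA; first by rewrite mul1r.
by rewrite mul0r.
Qed.

End density.

Section affine_change_of_variables.
Local Open Scope ereal_scope.
Context (R : realType).
Local Notation leb := (@lebesgue_measure R).
Variables (t s : R).
Hypothesis s0 : (0 < s)%R.

Let affine (y : R) : R := (t + s * y)%R.

Let maffine : measurable_fun [set: R] affine.
Proof.
by apply: measurable_funD => //; apply: measurable_funM.
Qed.

(** Scaled by [s], the image of Lebesgue measure under [y |-> t + s y] agrees
    with Lebesgue measure on half-open intervals, hence everywhere. *)
Lemma ge0_integral_affine (f : R -> \bar R) : measurable_fun [set: R] f ->
  (forall x, 0 <= f x) ->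
  \int[leb]_z f z = s%:E * \int[leb]_y f (t + s * y)%R.
Proof.
move=> mf f0.
pose s' : {nonneg R} := NngNum (ltW s0).
transitivity (\int[pushforward (mscale s' leb)
    (affine : measurableTypeR R -> measurableTypeR R)]_z f z).
  apply: eq_measure_integral => A mA _; apply: lebesgue_measure_unique => //.
  move=> _ [[a b] _ <-] /=.
  rewrite /pushforward /mscale /=.
  rewrite (_ : affine @^-1` _ = `]((a - t) / s)%R, ((b - t) / s)%R]%classic); last first.
    apply/seteqP; split => y; rewrite /affine/= !in_itv/= ltr_pdivrMr// ler_pdivlMr//.
      by move=> /andP[? ?]; apply/andP; split; lra.
    by move=> /andP[? ?]; apply/andP; split; lra.
  rewrite !lebesgue_measure_itv/= !lte_fin ltr_pM2r ?invr_gt0// ltrD2r.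
  case: ifPn => _; last by rewrite mule0.
  rewrite -!EFinB -EFinM; congr (_%:E); field; rewrite gt_eqF//.
rewrite ge0_integral_pushforward// preimage_setT ge0_integral_mscale//.
  exact: measurableT_comp.
by move=> x _; exact: f0.
Qed.

End affine_change_of_variables.

Section joint_law.
Local Open Scope ereal_scope.
Context d (T : measurableType d) (R : realType).
Variables (mu : {measure set T -> \bar R}) (g : T -> R).
Hypotheses (mg : measurable_fun [set: T] g) (g0 : forall x, (0 <= g x)%R).
Hypothesis gfin : \int[mu]_x (g x)%:E < +oo.

Definition density_measure (A : set T) : \bar R := \int[mu]_(x in A) (g x)%:E.

Let density0 : density_measure set0 = 0.
Proof. exact: integral_set0. Qed.

Let density_ge0 A : 0 <= density_measure A.
Proof. by apply: integral_ge0 => x _; rewrite lee_fin. Qed.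

Let density_sigma_additive : semi_sigma_additive density_measure.
Proof.
move=> F mF tF mUF; rewrite /density_measure ge0_integral_bigcup//.
- apply: is_cvg_nneseries => n _ _; exact: density_ge0.
- by apply/measurable_EFinP; exact: measurable_funTS.
- by move=> x _; rewrite lee_fin.
Qed.

HB.instance Definition _ := isMeasure.Build _ _ _ density_measure
  density0 density_ge0 density_sigma_additive.

Let density_fin : fin_num_fun density_measure.
Proof. exact: lty_fin_num_fun. Qed.

HB.instance Definition _ := Measure_isFinite.Build _ _ _ density_measure
  density_fin.

Context dO (Omega : measurableType dO) d2 (T2 : measurableType d2).
Variables (Q : {measure set Omega -> \bar R}).
Variables (b : probability T2 R) (U : Omega -> T) (W : Omega -> T2).
Hypotheses (mU : measurable_fun [set: Omega] U).
Hypotheses (mW : measurable_fun [set: Omega] W).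
Hypothesis indep : forall A E, measurable A -> measurable E ->
  Q (U @^-1` A `&` W @^-1` E) = \int[mu]_(x in A) (g x)%:E * b E.

(** A measure on a product is determined by its values on rectangles; the
    first marginal is given by a density so that the result is an integral for
    the reference measure. *)
Lemma joint_law S : measurable S ->
  Q [set w | S (U w, W w)] = \int[mu]_x (b [set y | S (x, y)] * (g x)%:E).
Proof.
move=> mS.
have mUW : measurable_fun [set: Omega] (fun w => (U w, W w)).
  exact/measurable_fun_pair.
have -> : Q [set w | S (U w, W w)] = (density_measure \x b) S.
  rewrite -/(pushforward Q (fun w => (U w, W w)) S).
  exact/esym/product_measure_unique.
rewrite -(@ge0_integral_density _ _ _ mu density_measure)//.
- by apply: eq_integral => x _ /=; congr (b _); apply/seteqP; split => y;
    rewrite /xsection/= inE.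
- rewrite (_ : (fun x => _) = b \o xsection S); first exact: measurable_fun_xsection.
  by apply/funext => x /=; congr (b _); apply/seteqP; split => y;
    rewrite /xsection/= inE.
Qed.

End joint_law.

(** * The support of a measure *)

Section support.
Context (R : realType) (m : {measure set (measurableTypeR R) -> \bar R}).

(** The complement of the support is covered by the countably many null
    intervals with rational endpoints. *)
Lemma msupport_full (A : set R) : @measurable _ (measurableTypeR R) A ->
  (0 < m A)%E -> exists2 e, msupport m e & A e.
Proof.
move=> mA A0; apply: contrapT => nA.
(* An enumeration of the null intervals with rational endpoints. *)
pose F n : set (measurableTypeR R) :=
  if unpickle n is Some qr then
    let J := `](ratr qr.1 : R), ratr qr.2[%classic in
    if `[< m J = 0%E >] then J else set0
  else set0.
have /negligibleP : m.-negligible A.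
  apply: (@negligibleS _ _ _ m (\bigcup_n F n)); last first.
    apply: negligible_bigcup => n; rewrite /F.
    case: (unpickle n) => [qr|]; last exact: negligible_set0.
    case: asboolP => [mJ|_]; last exact: negligible_set0.
    by apply/negligibleP => //; exact: measurable_itv.
  move=> x Ax.
  have [U [oU Ux mU]] : exists U : set R, [/\ open U, U x & m U = 0%E].
    apply: contrapT => nU; apply: nA; exists x => // U oU Ux.
    rewrite lt0e measure_ge0 andbT; apply/eqP => mU0.
    by apply: nU; exists U.
  have /nbhs_ballP[e /= e0 eU] : nbhs x U by exact: open_nbhs_nbhs.
  have xl : x - e < x by rewrite ltrBlDr ltrDl.
  have xr : x < x + e by rewrite ltrDl.
  have [q] := rat_in_itvoo xl; have [r] := rat_in_itvoo xr.
  rewrite !in_itv/= => /andP[r1 r2] /andP[q1 q2].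
  have [n nE] : exists n, unpickle n = Some (q, r).
    by exists (pickle (q, r)); rewrite pickleK.
  exists n => //; rewrite /F nE /=.
  case: asboolP => [_|]; first by rewrite /= in_itv/= q2 r1.
  case; apply/eqP; rewrite eq_le measure_ge0 andbT -[leRHS]mU.
  apply: le_measure; rewrite ?inE.
  - exact: measurable_itv.
  - exact: open_measurable.
  - move=> y; rewrite /= in_itv/= => /andP[y1 y2]; apply: eU.
    by rewrite /ball/= ltr_distlC; apply/andP; split; lra.
move=> /(_ mA) A00; by rewrite A00 ltxx in A0.
Qed.
End support.

(** * The transition density of the noisy map *)

Section transition_density.
Context (R : realType) (M : noisy_map R).
Local Notation leb := (@lebesgue_measure R).
Local Notation Gam := (Gamma M).
Local Notation I := (phase M).
Local Notation p := (trans_density M).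
Local Notation g := (noise_density M).
Hypothesis HM : assumption_TM M.

Lemma Upsilon_ge0 : 0 <= Upsilon M.
Proof.
have /andP[c0 c1] := tpeak_inside HM.
have /(tmap_unit HM) : tpeak M \in `[0, 1] by rewrite in_itv/= !ltW.
by rewrite in_itv/= => /andP[].
Qed.

Lemma Gamma_gt0 : 0 < Gam.
Proof. by rewrite subr_gt0 (Upsilon_lt1 HM). Qed.

Lemma Gamma_le1 : Gam <= 1.
Proof. by rewrite /Gamma; have := Upsilon_ge0; lra. Qed.

Lemma phaseE x : I x <-> - Gam <= x <= 1.
Proof. by rewrite /phase/= in_itv. Qed.

Lemma phase0 : I 0.
Proof. by apply/phaseE; have := Gamma_gt0; lra. Qed.

Lemma phase_measurable : measurable I.
Proof. exact: measurable_itv. Qed.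

Lemma phase_finite : (leb I < +oo)%E.
Proof. by rewrite /phase lebesgue_measure_itv/=; case: ifP; rewrite ?ltry. Qed.

Lemma tmap_phase x : I x -> 0 <= tmap M x <= Upsilon M.
Proof.
move=> /phaseE /andP[x1 x2].
have Ti := tmap_unit HM; have /andP[c0 c1] := tpeak_inside HM.
have [x0|x0] := leP 0 x.
  have /Ti : x \in `[0, 1] by rewrite in_itv/= x0.
  rewrite in_itv/= => /andP[-> _] /=.
  have [xc|xc|->//] := ltgtP x (tpeak M).
    by apply/ltW/(tmap_increasing HM) => //; rewrite in_itv/= ?x0 ?lexx ?andbT ltW.
  by apply/ltW/(tmap_decreasing HM) => //; rewrite in_itv/= ?x2 ?lexx ?ltW.
have /Ti : 0 \in `[0, 1 : R] by rewrite in_itv/= lexx ler01.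
rewrite in_itv/= => /andP[T0 _].
have G0 := Gamma_gt0.
apply/andP; split.
  apply: (le_trans T0); apply/ltW/(ext_decreasing HM) => //; rewrite in_itv/=; lra.
apply: (@le_trans _ _ (tmap M (- Gam))); last exact/ltW/(ext_left HM).
have [->//|xG] := eqVneq x (- Gam).
apply/ltW/(ext_decreasing HM); rewrite ?in_itv/=; [lra|lra|].
by rewrite lt_neqAle eq_sym xG.
Qed.

(** Otherwise the supremum, and then its inverse, would take the default value
    0, against the positivity of the amplitude. *)
Lemma sigma_bounded : has_sup (sigma M @` I).
Proof.
apply: contrapT => /sup_out E; have := amp_le HM; have := amp_gt0 HM.
by rewrite /sigma_max E invr0 mul0r; lra.
Qed.

Lemma sigma_le x : I x -> sigma M x <= sigma_max M.
Proof. by move=> Ix; apply: (sup_upper_bound sigma_bounded); exists x. Qed.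

Lemma sigma_max_gt0 : 0 < sigma_max M.
Proof.
rewrite lt0r (le_trans (sigma_ge0 HM 0) (sigma_le phase0)) andbT.
apply/eqP => E; have := amp_le HM; have := amp_gt0 HM.
by rewrite E invr0 mul0r; lra.
Qed.

Lemma noise_small x y : I x -> `|y| <= amp M -> `|sigma M x * y| <= Gam / 2.
Proof.
move=> Ix ya; have := amp_le HM.
rewrite ler_pdivlMl ?sigma_max_gt0// le_min => /andP[+ _].
apply: le_trans; rewrite normrM ger0_norm ?(sigma_ge0 HM)//.
by apply: ler_pM => //; [exact: (sigma_ge0 HM)|exact: sigma_le].
Qed.

Lemma noisy_phase x y : I x -> `|y| <= amp M ->
  - (Gam / 2) <= tmap_noisy M y x <= 1 - Gam / 2.
Proof.
move=> Ix ya; have := noise_small Ix ya; rewrite ler_norml => /andP[h1 h2].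
have /andP[t1 t2] := tmap_phase Ix; rewrite /tmap_noisy.
have UE : Upsilon M = 1 - Gam by rewrite /Gamma; lra.
by apply/andP; split; lra.
Qed.

Lemma phase_half z : - (Gam / 2) <= z <= 1 - Gam / 2 -> I z.
Proof. by move=> h; apply/phaseE; have := Gamma_gt0; lra. Qed.

Lemma derivable_measurable (f : R -> R) :
  (forall x, derivable f x 1) -> measurable_fun [set: R] f.
Proof.
move=> df; apply: continuous_measurable_fun => x.
exact/differentiable_continuous/derivable1_diffP.
Qed.

Lemma sigma_continuous : continuous (sigma M).
Proof.
by move=> x; apply/differentiable_continuous/derivable1_diffP/(sigma_derivable HM).
Qed.

Lemma noise_density_ge0 y : 0 <= g y.
Proof.
rewrite /noise_density !mulr_ge0 ?expR_ge0 ?(bump_ge0 HM)// invr_ge0.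
by apply: Rintegral_ge0 => x _; rewrite mulr_ge0 ?expR_ge0 ?(bump_ge0 HM).
Qed.

Lemma noise_density_supp y : amp M < `|y| -> g y = 0.
Proof. by move=> /(bump_supp HM) y0; rewrite /noise_density y0 mulr0 mul0r. Qed.

Lemma noise_density_measurable : measurable_fun [set: R] g.
Proof.
apply: measurable_funM.
  apply: measurable_funM => //.
  by apply: derivable_measurable => x; exact: (@bump_smooth _ _ HM 0%N x).
apply: continuous_measurable_fun => x.
apply: (continuous_comp (f := fun x : R => - (x ^+ 2 / 2))); last exact: continuous_expR.
apply: cvgN; apply: cvgM; last exact: cvg_cst.
exact: exprn_continuous.
Qed.

Lemma trans_density_ge0 x z : 0 <= p x z.
Proof.
by rewrite mulr_ge0 ?noise_density_ge0// invr_ge0 (sigma_ge0 HM).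
Qed.

Lemma trans_density_supp x z : I x -> p x z != 0 ->
  - (Gam / 2) <= z <= 1 - Gam / 2.
Proof.
move=> Ix; rewrite mulf_eq0 negb_or invr_eq0 => /andP[s0 g0].
have za : `|(z - tmap M x) / sigma M x| <= amp M.
  by rewrite leNgt; apply/negP => /noise_density_supp /eqP; rewrite (negbTE g0).
have := noisy_phase Ix za.
by rewrite /tmap_noisy mulrCA divff// mulr1 addrC subrK.
Qed.

Lemma trans_density_out x z : I x -> ~ I z -> p x z = 0.
Proof.
move=> Ix nz; apply/eqP/negPn/negP => /(trans_density_supp Ix) /phase_half.
exact: nz.
Qed.

Lemma trans_density_right x : I x -> p x 1 = 0.
Proof.
move=> Ix; apply/eqP/negPn/negP => /(trans_density_supp Ix).
have := Gamma_gt0; lra.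
Qed.

Lemma trans_density_measurable :
  measurable_fun [set: R * R] (fun xz => p xz.1 xz.2).
Proof.
have ms : measurable_fun [set: R * R] (fun xz : R * R => (sigma M xz.1)^-1).
  rewrite (_ : (fun _ => _) = (fun xz : R * R => powR (sigma M xz.1) (-1))).
    apply: (measurableT_comp (measurable_powR (-1))).
    by apply: measurableT_comp => //; exact: derivable_measurable (sigma_derivable HM).
  by apply/funext => xz; rewrite powR_inv1 ?(sigma_ge0 HM).
apply: measurable_funM => //.
apply: (measurableT_comp noise_density_measurable).
apply: measurable_funM => //; apply: measurable_funB => //.
by apply: measurableT_comp => //; exact: (tmap_measurable HM).
Qed.

Lemma trans_density_measurable1 x : measurable_fun [set: R] (p x).
Proof.
exact: (measurableT_comp trans_density_measurable (measurable_pair1 x)).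
Qed.

Lemma trans_density_measurable2 z : measurable_fun [set: R] (p ^~ z).
Proof.
exact: (measurableT_comp trans_density_measurable (measurable_pair2 z)).
Qed.

Section variation_bound.
Hypothesis gint : (\int[leb]_y (g y)%:E = 1)%E.
Hypothesis HTV : (ess_sup leb
    ((fun x => total_variation (- Gam) 1 (p x)) \_ I) < +oo)%E.

Lemma kernel_variation_ae : exists2 V : R, 0 <= V &
  {ae leb, forall x, I x -> (total_variation (- Gam) 1 (p x) <= V%:E)%E}.
Proof.
have [V V0 HV] : exists2 V : R, 0 <= V & (ess_sup leb
    ((fun x => total_variation (- Gam) 1 (p x)) \_ I) <= V%:E)%E.
  case: (ess_sup _ _) HTV => [r _||].
  - by exists `|r|; rewrite ?normr_ge0// lee_fin ler_norm.
  - by rewrite ltxx.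
  - by exists 0; rewrite ?leNye.
exists V => //; move/ess_supP: HV; apply: filterS => x + Ix.
by rewrite patchE mem_set.
Qed.

(** The density [p x] vanishes at the right end of the phase space, so it is
    bounded by its variation. *)
Lemma trans_density_le V x z : I x -> I z ->
  (total_variation (- Gam) 1 (p x) <= V%:E)%E -> p x z <= V.
Proof.
move=> Ix /phaseE /andP[z0 z1] HV.
rewrite -lee_fin; apply: le_trans HV.
rewrite (total_variationD _ z0 z1).
apply: (@le_trans _ _ (total_variation z 1 (p x))); last first.
  by rewrite leeDr// total_variation_ge0.
apply: le_trans (total_variation_ge _ z1).
by rewrite (trans_density_right Ix) sub0r normrN ger0_norm// trans_density_ge0.
Qed.

Lemma noise_density_pos : exists2 y, `|y| <= amp M & 0 < g y.
Proof.
have [y by0] := bump_neq0 HM; exists y.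
  by rewrite leNgt; apply/negP => /(bump_supp HM) /eqP; rewrite (negbTE by0).
rewrite lt0r noise_density_ge0 andbT /noise_density mulf_neq0//; last first.
  by rewrite gt_eqF ?expR_gt0.
rewrite mulf_neq0//; apply/eqP => c0; move: gint.
rewrite integral0_eq; last first.
  by move=> x _; rewrite /noise_density c0 !mul0r.
by move=> /eqP; rewrite eq_sym onee_eq0.
Qed.

(** At a point where [sigma] is positive and small the kernel has a high peak.
    The essential bound on its variation leaves no open set of such points, so
    by the intermediate value theorem a zero of [sigma] would force [sigma] to
    vanish on the whole phase space. *)
Lemma sigma_gt0 x : I x -> 0 < sigma M x.
Proof.
move=> Ix; rewrite lt0r (sigma_ge0 HM) andbT; apply/eqP => sx0.
have [x1 Ix1 sx1] : exists2 x1, I x1 & 0 < sigma M x1.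
  apply: contrapT => nx; have := sigma_max_gt0; apply/negP; rewrite -leNgt.
  apply: ge_sup; first by case: sigma_bounded.
  by move=> _ [y Iy <-]; rewrite leNgt; apply/negP => sy; apply: nx; exists y.
have [y ya gy] := noise_density_pos.
have [V V0 HV] := kernel_variation_ae.
(* A value taken by [sigma], at which the peak of the kernel exceeds [V]. *)
pose v := Num.min (sigma M x1) (g y / (V + 1)) / 2.
have m0 : 0 < Num.min (sigma M x1) (g y / (V + 1)).
  by rewrite lt_min sx1 divr_gt0//; lra.
have v0 : 0 < v by rewrite divr_gt0.
have vx1 : v < sigma M x1.
  have : Num.min (sigma M x1) (g y / (V + 1)) <= sigma M x1 by rewrite ge_min lexx.
  by rewrite /v; lra.
have vV : v * V < g y.
  have : Num.min (sigma M x1) (g y / (V + 1)) <= g y / (V + 1).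
    by rewrite ge_min lexx orbT.
  rewrite ler_pdivlMr; last lra.
  have := mulr_ge0 (ltW m0) V0; rewrite /v; move: m0.
  set m := Num.min _ _ => m0 mV; rewrite mulrDr mulr1 => h.
  by rewrite mulrAC; lra.
have [x2 x2I sx2] : exists2 x2 : R,
    Num.min x x1 < x2 < Num.max x x1 & sigma M x2 = v.
  have sc a b : {within `[a, b], continuous (sigma M)}.
    by apply: continuous_subspaceT => z; exact: sigma_continuous.
  have nx z : sigma M z = v -> z != x /\ z != x1.
    by move=> sz; split; apply/eqP => zE; move: sz; rewrite zE; lra.
  have [xx1|xx1] := leP x x1.
    have [|x2] := IVT (v := v) xx1 (sc x x1).
      by rewrite sx0 ge_min le_max (ltW v0) (ltW vx1) orbT.
    rewrite in_itv/= => /andP[h1 h2] h3; have [n1 n2] := nx _ h3.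
    by exists x2 => //; rewrite !lt_neqAle h1 h2 eq_sym n1 n2.
  have [|x2] := IVT (v := v) (ltW xx1) (sc x1 x).
    by rewrite sx0 ge_min le_max (ltW v0) (ltW vx1) orbT.
  rewrite in_itv/= => /andP[h1 h2] h3; have [n1 n2] := nx _ h3.
  by exists x2 => //; rewrite !lt_neqAle h1 h2 [_ == x2]eq_sym n1 n2.
have : \forall z \near x2, [/\ I z, 0 < sigma M z & sigma M z * V < g y].
  near=> z; split.
  - have /andP[z1 z2] : Num.min x x1 < z < Num.max x x1.
      have : z \in `]Num.min x x1, Num.max x x1[.
        by near: z; apply: near_in_itvoo; rewrite in_itv.
      by rewrite in_itv.
    move: Ix Ix1 => /phaseE /andP[a1 a2] /phaseE /andP[b1 b2].
    apply/phaseE; apply/andP; split.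
      by apply: le_trans (ltW z1); rewrite le_min a1 b1.
    by apply: (le_trans (ltW z2)); rewrite ge_max a2 b2.
  - by near: z; move/cvgr_gt: (@sigma_continuous x2); apply; rewrite sx2.
  - near: z; have : (fun z => sigma M z * V) @ x2 --> sigma M x2 * V.
      by apply: cvgM; [exact: sigma_continuous|exact: cvg_cst].
    by move/cvgr_lt; apply; rewrite sx2.
move=> /nbhs_ballP[e /= e0 be].
have /negligibleP : leb.-negligible (ball x2 e).
  apply: negligibleS HV => z /be [Iz sz szV] /= /(_ Iz) H.
  have Iw : I (tmap_noisy M y z) by apply: phase_half; exact: noisy_phase.
  have := trans_density_le Iz Iw H.
  rewrite /trans_density /tmap_noisy addrAC subrr add0r mulrC.
  rewrite [X in g X]mulrC mulKf ?gt_eqF// ler_pdivrMr// mulrC.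
  by rewrite leNgt szV.
move=> /(_ (measurable_ball _ _)) H.
have := etrans (esym (lebesgue_measure_ball x2 (ltW e0))) H.
by move/eqP; rewrite eqe mulrn_eq0/= gt_eqF.
Unshelve. all: by end_near. Qed.

End variation_bound.

Section positive_amplitude.
Hypothesis gint : (\int[leb]_y (g y)%:E = 1)%E.
Hypothesis s0 : forall x, I x -> 0 < sigma M x.

(** The kernel is the law of [tmap_noisy M y x] when [y] has the density of the
    noise. *)
Lemma trans_density_push x (f : R -> \bar R) : I x ->
  measurable_fun [set: R] f -> (forall z, 0 <= f z)%E ->
  (\int[leb]_z (f z * (p x z)%:E) =
   \int[leb]_y (f (tmap_noisy M y x) * (g y)%:E))%E.
Proof.
move=> Ix mf f0; have sx := s0 Ix.
have maff : measurable_fun [set: R] (fun y => tmap M x + sigma M x * y).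
  by apply: measurable_funD => //; apply: measurable_funM.
rewrite (@ge0_integral_affine _ (tmap M x) (sigma M x))//; last 2 first.
- apply: emeasurable_funM => //; apply/measurable_EFinP.
  exact: trans_density_measurable1.
- by move=> z; rewrite mule_ge0// lee_fin trans_density_ge0.
rewrite -ge0_integralZl//; last 3 first.
- apply: emeasurable_funM; first exact: (measurableT_comp mf maff).
  apply/measurable_EFinP.
  exact: (measurableT_comp (trans_density_measurable1 x) maff).
- by move=> z _; rewrite mule_ge0// lee_fin trans_density_ge0.
- by rewrite lee_fin ltW.
apply: eq_integral => y _; rewrite muleCA; congr (_ * _)%E.
rewrite -EFinM /trans_density mulrA divff ?gt_eqF// mul1r.
by congr (g _)%:E; rewrite addrAC subrr add0r mulrC mulKf// gt_eqF.
Qed.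

Lemma trans_density_int x : I x -> (\int[leb]_(z in I) (p x z)%:E = 1)%E.
Proof.
move=> Ix; rewrite -gint integral_mkcond.
transitivity (\int[leb]_z (cst 1 z * (p x z)%:E))%E.
  apply: eq_integral => z _; rewrite mul1e patchE; case: ifPn => //.
  by move=> /negP zI; rewrite trans_density_out// => /mem_set.
rewrite trans_density_push//.
by apply: eq_integral => y _; rewrite mul1e.
Qed.

Lemma noise_law_push x A : I x -> measurable A ->
  noise_law M [set y | A (tmap_noisy M y x)] = (\int[leb]_(z in A) (p x z)%:E)%E.
Proof.
move=> Ix mA; rewrite /noise_law integral_mkcond [RHS]integral_mkcond.
transitivity (\int[leb]_y ((\1_A (tmap_noisy M y x))%:E * (g y)%:E))%E.
  apply: eq_integral => y _; rewrite patchE indicE.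
  rewrite (_ : (y \in _) = (tmap_noisy M y x \in A)); last first.
    by apply/idP/idP; rewrite !inE.
  by case: ifPn => _; rewrite ?mul1e ?mul0e.
rewrite -(@trans_density_push x (EFin \o \1_A))//.
- apply: eq_integral => z _; rewrite /= patchE indicE.
  by case: ifPn => _; rewrite ?mul1e ?mul0e.
- by apply/measurable_EFinP; exact: measurable_indic.
- by move=> z; rewrite lee_fin.
Qed.

End positive_amplitude.

End transition_density.

(** * The Markov operator on bounded functions *)

Section ae_domination.
Context d (T : measurableType d) (R : realType).
Variables (mu : {measure set T -> \bar R}) (I : set T).
Hypothesis mI : measurable I.

(** The kernel is bounded only for almost every starting point, which is why the
    domination is almost everywhere. *)
Lemma ae_dominated (u w : T -> R) : measurable_fun [set: T] u ->
  mu.-integrable I (EFin \o w) -> (forall x, I x -> 0 <= w x) ->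
  {ae mu, forall x, I x -> `|u x| <= w x} ->
  mu.-integrable I (EFin \o u) /\
  \int[mu]_(x in I) `|u x| <= \int[mu]_(x in I) w x.
Proof.
move=> mu_ iw w0 uw.
have muI : measurable_fun I (EFin \o u).
  by apply/measurable_EFinP; exact: measurable_funTS.
have mnu : measurable_fun I (fun x => `|u x|%:E).
  by apply/measurable_EFinP; apply: measurableT_comp => //; exact: measurable_funTS.
have mw : measurable_fun I (fun x => (w x)%:E) := measurable_int mu iw.
have le : (\int[mu]_(x in I) `|u x|%:E <= \int[mu]_(x in I) (w x)%:E)%E.
  by apply: ae_ge0_le_integral => // x Ix; rewrite lee_fin// w0.
have fw : (\int[mu]_(x in I) (w x)%:E \is a fin_num)%E by exact: integrable_fin_num.
have iu : mu.-integrable I (EFin \o u).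
  by apply/integrableP; split => //; apply: le_lt_trans le _; rewrite ltey_eq fw.
split => //; apply: fine_le => //.
rewrite ge0_fin_numE; last by apply: integral_ge0 => x _; rewrite lee_fin.
by apply: le_lt_trans le _; rewrite ltey_eq fw.
Qed.

End ae_domination.

Section markov_operator.
Context (R : realType) (M : noisy_map R).
Local Notation leb := (@lebesgue_measure R).
Local Notation Gam := (Gamma M).
Local Notation I := (phase M).
Local Notation p := (trans_density M).
Local Notation g := (noise_density M).
Local Notation L := (markov M).
Local Notation J := (Rintegral leb I).
Local Notation good := (@bounded_measurable _ (measurableTypeR R) R I).
Hypothesis HM : assumption_TM M.
Hypothesis gint : (\int[leb]_y (g y)%:E = 1)%E.
Hypothesis s0 : forall x, I x -> 0 < sigma M x.
Variable V : R.
Hypothesis V0 : 0 <= V.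
Hypothesis HV : {ae leb, forall x, I x ->
  (total_variation (- Gam) 1 (p x) <= V%:E)%E}.

Let mI : @measurable _ (measurableTypeR R) I := phase_measurable M.
Let finI : (leb I < +oo)%E := phase_finite M.


Let good_int f : good f -> leb.-integrable I (EFin \o f).
Proof. exact: (@bm_integrable _ (measurableTypeR R) R leb I mI finI f). Qed.

#[local] Instance ae_lebesgue_filter :
  Filter (nbhs (almost_everywhere (@lebesgue_measure R))).
Proof. exact: (ae_filter_ringOfSetsType (@lebesgue_measure R)). Qed.

Lemma trans_density_ae z : {ae leb, forall x, I x -> `|p x z| <= V}.
Proof.
apply: filterS HV => x H Ix.
rewrite ger0_norm ?(trans_density_ge0 HM)//.
have [Iz|nIz] := pselect (I z); first exact: (trans_density_le HM Ix Iz (H Ix)).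
by rewrite (trans_density_out HM).
Qed.

Lemma markov_integrable f z : measurable_fun [set: R] f ->
  leb.-integrable I (EFin \o f) ->
  leb.-integrable I (EFin \o (fun x => f x * p x z)) /\
  J (fun x => `|f x * p x z|) <= V * J (fun x => `|f x|).
Proof.
move=> mf If.
have In : leb.-integrable I (EFin \o (fun x => `|f x|)) by exact: integrable_norm.
rewrite -RintegralZl//; apply: ae_dominated => //.
- by apply: measurable_funM => //; exact: (trans_density_measurable2 HM).
- by rewrite (_ : _ \o _ = (fun x => V%:E * (`|f x|)%:E)%E)//; exact: integrableZl.
- by move=> x _; exact: mulr_ge0.
- apply: filterS (trans_density_ae z) => x H Ix.
  by rewrite normrM mulrC; apply: ler_wpM2r => //; exact: H.
Qed.

Lemma markov_integrable_le f z : measurable_fun [set: R] f ->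
  leb.-integrable I (EFin \o f) -> `|L f z| <= V * J (fun x => `|f x|).
Proof.
move=> mf If; have [H1 H2] := markov_integrable z mf If.
exact: le_trans (le_normr_Rintegral _ H1) H2.
Qed.

Lemma markov_le f z : good f -> `|L f z| <= V * J (fun x => `|f x|).
Proof. by move=> gf; apply: markov_integrable_le; [case: gf|exact: good_int]. Qed.

Lemma markov_eq_on f g' : eq_on (- Gam) 1 f g' -> L f = L g'.
Proof.
move=> fg; apply/funext => z; apply: eq_Rintegral => x.
by rewrite inE => Ix; rewrite fg// inE.
Qed.

Lemma markov_out f z : ~ I z -> L f z = 0.
Proof.
move=> nz; rewrite /markov (@eq_Rintegral _ _ _ leb I (fun=> 0)).
  by rewrite Rintegral_cst// mul0r.
by move=> x; rewrite inE => Ix; rewrite (trans_density_out HM)// mulr0.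
Qed.

Lemma markov_linear c f f' : good f -> good f' ->
  L (fun x => c * f x + f' x) = (fun x => c * L f x + L f' x).
Proof.
move=> gf gf'; apply/funext => z.
have [i1 _] := markov_integrable z gf.1 (good_int gf).
have [i2 _] := markov_integrable z gf'.1 (good_int gf').
rewrite /markov -RintegralZl// -RintegralD//; last first.
  by rewrite (_ : _ \o _ = (fun x => c%:E * (f x * p x z)%:E)%E)//; exact: integrableZl.
by congr fine; apply: eq_integral => x _; rewrite mulrDl mulrA.
Qed.

Lemma markov_fubini f : good f ->
  measurable_fun [set: R] (L f) /\ J (L f) = J f.
Proof.
move=> gf; have [mf [A fA]] := gf.
pose F (xz : R * R) : \bar R := (\1_I xz.1 * (f xz.1 * p xz.1 xz.2))%:E.
have mF : measurable_fun [set: R * R] F.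
  apply/measurable_EFinP; apply: measurable_funM.
    have m1 : measurable_fun [set: R] (\1_I : R -> R) by exact: measurable_indic.
    exact: (measurableT_comp m1 measurable_fst).
  apply: measurable_funM; first exact: (measurableT_comp mf measurable_fst).
  exact: (trans_density_measurable HM).
have pint x : I x -> (\int[leb]_z (p x z)%:E = 1)%E.
  move=> Ix; rewrite -(trans_density_int HM gint s0 Ix) [RHS]integral_mkcond.
  apply: eq_integral => z _; rewrite patchE; case: ifPn => // /negP zI.
  by rewrite (trans_density_out HM)// => /mem_set.
have Fx x : (\int[leb]_z F (x, z) = (\1_I x * f x)%:E)%E.
  rewrite /F/= indicE; case: (boolP (x \in I)) => [/set_mem Ix|_] /=; last first.
    by rewrite mul0r integral0_eq// => z _; rewrite mul0r.
  rewrite mul1r.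
  under eq_integral do rewrite mul1r EFinM.
  rewrite integralZl//; last first.
    apply/integrableP; split.
      by apply/measurable_EFinP; exact: (trans_density_measurable1 HM x).
    under eq_integral do rewrite gee0_abs ?lee_fin ?(trans_density_ge0 HM)//.
    by rewrite pint// ltry.
  by rewrite pint// mule1.
have Fax x : (\int[leb]_z `|F (x, z)| = (\1_I x * `|f x|)%:E)%E.
  rewrite /F/= indicE; case: (boolP (x \in I)) => [/set_mem Ix|_] /=; last first.
    by rewrite mul0r integral0_eq// => z _; rewrite mul0r normr0.
  rewrite mul1r.
  under eq_integral do rewrite mul1r normrM EFinM (ger0_norm (trans_density_ge0 HM _ _)).
  rewrite ge0_integralZl//.
  - by rewrite pint// mule1.
  - by apply/measurable_EFinP; exact: (trans_density_measurable1 HM x).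
  - by move=> z _; rewrite lee_fin (trans_density_ge0 HM).
have If := good_int gf.
have iF : (leb \x leb)%E.-integrable setT F.
  apply/integrable12ltyP => //.
  under eq_integral do rewrite Fax.
  have [_] := integrableP _ _ _ If; rewrite [X in (X < _)%E -> _]integral_mkcond.
  apply: le_lt_trans; rewrite le_eqVlt; apply/orP; left; apply/eqP.
  apply: eq_integral => x _; rewrite patchE indicE.
  by case: ifPn => _; rewrite ?mul1r ?mul0r.
have Gz z : (\int[leb]_x F (x, z) = \int[leb]_(x in I) (f x * p x z)%:E)%E.
  rewrite [RHS]integral_mkcond; apply: eq_integral => x _; rewrite /F/= patchE indicE.
  by case: ifPn => _; rewrite ?mul1r ?mul0r.
have LG z : L f z = fine (\int[leb]_x F (x, z))%E by rewrite Gz.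
split.
  rewrite (_ : L f = fine \o fubini_G leb F); last exact/funext.
  by apply: measurableT_comp => //; exact: (measurable_fubini_G iF).
have := integral12_prod_meas1 iF; rewrite -(integral21_prod_meas1 iF) => E.
rewrite /Rintegral; congr fine; transitivity (\int[leb]_z fubini_G leb F z)%E; last first.
  rewrite -E [RHS]integral_mkcond; apply: eq_integral => x _.
  rewrite /fubini_F Fx patchE indicE.
  by case: ifPn => _; rewrite ?mul1r ?mul0r.
rewrite [LHS]integral_mkcond; apply: eq_integral => z _.
rewrite /fubini_G Gz patchE; case: ifPn => [_|/negP zI].
  have [iz _] := markov_integrable z mf If.
  have fz : (\int[leb]_(x in I) (f x * p x z)%:E)%E \is a fin_num.
    exact: (@integrable_fin_num _ (measurableTypeR R) R leb I mI _ iz).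
  exact: (fineK fz).
have nz : ~ I z by move=> /mem_set.
apply/esym/integral0_eq => x Ix.
by rewrite (trans_density_out HM Ix nz) mulr0.
Qed.

Lemma markov_bm f : good f -> good (L f).
Proof.
move=> gf; split; first by case: (markov_fubini gf).
by exists (V * J (fun x => `|f x|)) => z _; exact: markov_le.
Qed.

(** The increments of [L f] along a partition are integrals of [f] against
    those of the kernel, whose absolute values sum to at most its variation. *)
Lemma markov_variation f s : good f -> itv_partition (- Gam) 1 s ->
  variation (- Gam) 1 (L f) s <= V * J (fun x => `|f x|).
Proof.
move=> gf ps.
pose z := nth 1 (- Gam :: s).
have mp n : measurable_fun [set: R] (p ^~ (z n)) by exact: (trans_density_measurable2 HM).
pose dp n x := `|p x (z n.+1) - p x (z n)|.
have mdp n : measurable_fun [set: R] (fun x => `|f x| * \sum_(0 <= i < n) dp i x).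
  apply: measurable_funM; first by case: (bm_norm gf).
  apply: measurable_sum => i; apply: measurableT_comp => //.
  exact: measurable_funB.
have If := good_int gf.
have Ifn := good_int (bm_norm gf).
have ip n := (markov_integrable (z n) gf.1 If).1.
have idp n : leb.-integrable I (EFin \o (fun x => `|f x| * dp n x)).
  apply: (eq_integrable mI _ _ _ (integrable_norm (integrableB mI (ip n.+1) (ip n)))).
  by move=> x _ /=; rewrite -mulrBr normrM.
have sum0 n x : 0 <= \sum_(0 <= i < n) dp i x.
  by apply: sumr_ge0 => i _; exact: normr_ge0.
have isum n : leb.-integrable I (EFin \o (fun x => `|f x| * \sum_(0 <= i < n) dp i x)) /\
  \sum_(0 <= i < n) `|L f (z i.+1) - L f (z i)| <=
  J (fun x => `|f x| * \sum_(0 <= i < n) dp i x).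
  elim: n => [|n [ih1 ih2]].
    rewrite !big_geq//; split.
      rewrite (_ : _ \o _ = cst 0%E); first exact: integrable0.
      by apply/funext => x /=; rewrite big_geq// mulr0.
    apply: Rintegral_ge0 => x _; by rewrite big_geq// mulr0.
  have E : (fun x => `|f x| * \sum_(0 <= i < n.+1) dp i x) =
      (fun x => `|f x| * (\sum_(0 <= i < n) dp i x) + `|f x| * dp n x).
    by apply/funext => x; rewrite big_nat_recr//= mulrDr.
  rewrite E; split; first exact: (integrableD mI ih1 (idp n)).
  rewrite RintegralD// big_nat_recr//=; apply: lerD => //.
  rewrite /markov -RintegralB//.
  apply: le_trans (le_normr_Rintegral _ _) _ => //.
    exact: (integrableB mI (ip n.+1) (ip n)).
  rewrite le_eqVlt; apply/orP; left; apply/eqP.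
  by apply: eq_Rintegral => x _; rewrite -mulrBr normrM.
apply: le_trans (isum (size s)).2 _.
rewrite -RintegralZl//.
have := @ae_dominated _ _ _ leb I mI (fun x => `|f x| * \sum_(0 <= i < size s) dp i x)
  (fun x => V * `|f x|) (mdp _).
have iV : leb.-integrable I (EFin \o (fun x => V * `|f x|)).
  by apply: good_int; apply: bmZ; exact: bm_norm.
move=> /(_ iV) [||_].
- by move=> x _; exact: mulr_ge0.
- apply: filterS HV => x H Ix.
  rewrite normrM normr_id (ger0_norm (sum0 _ _)) mulrC; apply: ler_wpM2r => //.
  rewrite -lee_fin; apply: le_trans (H Ix); apply: ereal_sup_ubound.
  by exists (variation (- Gam) 1 (p x) s) => //; exists s.
apply: le_trans; rewrite le_eqVlt; apply/orP; left; apply/eqP.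
by apply: eq_Rintegral => x _; rewrite [RHS]ger0_norm// mulr_ge0.
Qed.

Let a1 : - Gam <= 1.
Proof. by have := Gamma_gt0 HM; lra. Qed.

Lemma markov_bv f : good f -> bounded_variation (- Gam) 1 (L f).
Proof.
by move=> gf; exists (V * J (fun x => `|f x|)) => _ [s ps <-]; exact: markov_variation.
Qed.

Lemma markov_bv_norm f : good f ->
  bv_norm (- Gam) 1 (L f) <= V * (1 + fine (leb I)) * J (fun x => `|f x|).
Proof.
move=> gf; set A := J _.
have -> : V * (1 + fine (leb I)) * A = V * A + V * A * fine (leb I) by ring.
apply: lerD.
  have tv : (total_variation (- Gam) 1 (L f) <= (V * A)%:E)%E.
    apply: ub_ereal_sup => _ [_ [s ps <-] <-]; rewrite lee_fin.
    exact: markov_variation.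
  rewrite -lee_fin fineK//.
  by apply/bounded_variationP => //; exact: markov_bv.
have <- := Rintegral_cst leb mI (V * A).
have iL : leb.-integrable I (EFin \o (fun x => `|L f x|)).
  by apply: good_int; apply: bm_norm; exact: markov_bm.
have ic : leb.-integrable I (EFin \o (fun=> V * A)) by apply: good_int; exact: bm_cst.
apply: (le_Rintegral mI iL ic) => x _; exact: markov_le.
Qed.

End markov_operator.

(** * Spectral decay from the gap on functions of bounded variation *)

Section bv_congruence.
Context (R : realType) (a b : R).
Implicit Types f g : R -> R.

Lemma eq_on_variation f g s : eq_on a b f g -> itv_partition a b s ->
  variation a b f s = variation a b g s.
Proof.
move=> fg ps; have zI n : (n <= size s)%N -> nth b (a :: s) n \in `[a, b].
  move=> ns; rewrite in_itv/=; apply/andP; split.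
    exact: itv_partition_nth_ge ps.
  exact: itv_partition_nth_le ps.
rewrite /variation; apply: eq_big_nat => n /andP[_ ns] /=.
by rewrite (fg _ (zI _ ns)) (fg _ (zI _ (ltnW ns))).
Qed.

Lemma eq_on_variations f g : eq_on a b f g -> variations a b f = variations a b g.
Proof.
move=> fg; apply/seteqP; split => _ [s ps <-]; exists s => //.
  by rewrite (eq_on_variation fg).
by rewrite (eq_on_variation fg).
Qed.

Lemma eq_on_bv f g : eq_on a b f g ->
  bounded_variation a b g -> bounded_variation a b f.
Proof. by move=> fg; rewrite /bounded_variation (eq_on_variations fg). Qed.

Lemma eq_on_bv_norm f g : eq_on a b f g -> bv_norm a b f = bv_norm a b g.
Proof.
move=> fg; rewrite /bv_norm /total_variation (eq_on_variations fg); congr (_ + _).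
by apply: eq_Rintegral => x; rewrite inE => xab; rewrite fg.
Qed.

Lemma le_bv_norm f : a <= b ->
  \int[lebesgue_measure]_(x in `[a, b]) `|f x| <= bv_norm a b f.
Proof. by move=> ab; rewrite lerDr fine_ge0// total_variation_ge0. Qed.

Lemma bv_norm_ge0 f : a <= b -> 0 <= bv_norm a b f.
Proof.
by move=> ab; apply: le_trans (le_bv_norm f ab); exact: Rintegral_ge0.
Qed.

Lemma bv_norm0 : a <= b -> bv_norm a b (fun=> 0) = 0.
Proof.
move=> ab; rewrite /bv_norm.
have -> : total_variation a b (fun=> 0) = 0%E.
  apply/eqP; rewrite eq_le total_variation_ge0// andbT.
  apply: ub_ereal_sup => _ [_ [s ps <-] <-].
  by rewrite /variation big1// => i _ /=; rewrite subrr normr0.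
rewrite add0r.
under [X in X = _]eq_Rintegral do rewrite normr0.
by rewrite Rintegral_cst// mul0r.
Qed.

End bv_congruence.

Section spectral_decay.
Context (R : realType) (M : noisy_map R).
Variables (mu : probability (measurableTypeR R) R) (h : R -> R).
Local Notation leb := (@lebesgue_measure R).
Local Notation Gam := (Gamma M).
Local Notation I := (phase M).
Local Notation p := (trans_density M).
Local Notation L := (markov M).
Local Notation J := (Rintegral leb I).
Local Notation BV := (bounded_variation (- Gam) 1).
Local Notation good := (@bounded_measurable _ (measurableTypeR R) R I).
Local Notation "f =I g" := (eq_on (- Gam) 1 f g) (at level 70).
Hypothesis HM : assumption_TM M.
Hypothesis gint : (\int[leb]_y (noise_density M y)%:E = 1)%E.
Hypothesis s0 : forall x, I x -> 0 < sigma M x.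
Variable V : R.
Hypothesis V0 : 0 <= V.
Hypothesis HV : {ae leb, forall x, I x ->
  (total_variation (- Gam) 1 (p x) <= V%:E)%E}.
Hypothesis SF : standing_facts M mu h.

Let mI : @measurable _ (measurableTypeR R) I := phase_measurable M.
Let finI : (leb I < +oo)%E := phase_finite M.
Let good_int f : good f -> leb.-integrable I (EFin \o f).
Proof. exact: (@bm_integrable _ (measurableTypeR R) R leb I mI finI f). Qed.
Let a1 : - Gam <= 1.
Proof. by have := Gamma_gt0 HM; lra. Qed.

Lemma stationary_density_out z : ~ I z -> h z = 0.
Proof.
move=> nz; apply: (h_supp SF); rewrite in_itv/=; apply/negP => /andP[z1 z2].
apply: nz; apply/phaseE; have G0 := Gamma_gt0 HM.
have : I (1 - Gam / 2) by apply/phaseE; have := Gamma_le1 HM; lra.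
by move=> /(tmap_phase HM); lra.
Qed.

Lemma stationary_fixed : L h = h.
Proof.
apply/funext => z; have [Iz|nz] := pselect (I z); first exact: (h_fixed SF).
by rewrite (markov_out HM)// stationary_density_out.
Qed.

Lemma stationary_integrable : leb.-integrable I (EFin \o h).
Proof.
apply/integrableP; split.
  by apply/measurable_EFinP; apply: measurable_funTS; exact: (h_measurable SF).
rewrite (_ : (\int[leb]_(x in I) `|(EFin \o h) x|)%E = mu I).
  by have [-> _] := mu_stationary SF; rewrite ltry.
rewrite (mu_density SF)//; apply: eq_integral => x _ /=.
by rewrite ger0_norm// (h_ge0 SF).
Qed.

Lemma stationary_int : J h = 1.
Proof.
by rewrite /Rintegral -(mu_density SF)//; have [-> _] := mu_stationary SF.
Qed.

Lemma stationary_bm : good h.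
Proof.
split; first exact: (h_measurable SF).
exists (V * J (fun x => `|h x|)) => z _; rewrite -[in `|h z|]stationary_fixed.
apply: (markov_integrable_le HM V0 HV); first exact: (h_measurable SF).
exact: stationary_integrable.
Qed.
Let gh := stationary_bm.

Let bvL f : good f -> BV (L f).
Proof. exact: (markov_bv HM V0 HV). Qed.

Let bv_h : BV h.
Proof. by rewrite -stationary_fixed; exact: bvL. Qed.

Let gL f : good f -> good (L f).
Proof. exact: (markov_bm HM gint s0 V0 HV). Qed.

Let JL f : good f -> J (L f) = J f.
Proof. by move=> gf; have [] := markov_fubini HM gint s0 V0 HV gf. Qed.

Let linL c f f' : good f -> good f' ->
  L (fun x => c * f x + f' x) = (fun x => c * L f x + L f' x).
Proof. exact: (markov_linear HM V0 HV). Qed.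

Let J_const_h k f : f =I (fun x => k * h x) -> J (fun x => `|f x|) = `|k|.
Proof.
move=> fk; rewrite -[RHS]mulr1 -stationary_int.
rewrite -[RHS](RintegralZl _ mI stationary_integrable).
apply: eq_Rintegral => x; rewrite inE => Ix.
by rewrite fk ?inE// normrM [`|h x|]ger0_norm// (h_ge0 SF).
Qed.

(** The projection [Pi] has rank one and its range contains a fixed function of
    [L]; as 1 is a simple eigenvalue, the range consists of multiples of [h]. If
    [J f = 0], then [L f] has bounded variation and [L^n (L f)] approaches
    [Pi (L f) = k h], where [k = J (k h)] is the limit of integrals which are
    all zero. So [L^n (L f)] is itself the part of norm [O(rho^n)]. *)
Lemma spectral_decay : exists C rho : R, [/\ 0 <= C, 0 <= rho, rho < 1 &
  forall n f x, good f -> J f = 0 ->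
    `|iter n.+2 L f x| <= C * rho ^+ n * J (fun y => `|f y|)].
Proof.
have [Pi [[_ Pilin [K PiK]] [e [bve e0 Pie Pi1]] LPi [C [rho [rho0 rho1 dec]]]]]
  := markov_gap SF.
have bv_ext f f' : f =I f' -> BV f' -> BV f by exact: eq_on_bv.
have bv0 : BV (fun=> 0).
  exists 0 => _ [s _ <-]; rewrite /variation big1// => i _ /=.
  by rewrite subrr normr0.
(* The range of [Pi] consists of multiples of [h] on the phase space. *)
have [kap kap0 ekap] : exists2 kap, kap != 0 & e =I (fun x => kap * h x).
  have [e' [bve' e'0 _ simple]] := markov_simple SF.
  have fixe f : BV f -> L f =I f -> exists c, f =I (fun x => c * e' x).
    move=> bvf Lf; apply: (simple 1%N) => // x xI /=.
    by rewrite Lf// mul1r subrr.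
  have [ch hE] : exists c, h =I (fun x => c * e' x).
    by apply: fixe => // x _; rewrite stationary_fixed.
  have [ce eE] : exists c, e =I (fun x => c * e' x).
    apply: fixe => // x xI; rewrite -(markov_eq_on Pie).
    by have [-> //] := LPi _ bve; rewrite Pie.
  have ch0 : ch != 0.
    apply/eqP => ch0; have := stationary_int.
    rewrite /Rintegral integral0_eq ?fine0; first by move/eqP; rewrite eq_sym oner_eq0.
    by move=> x Ix; rewrite hE ?inE// ch0 mul0r.
  exists (ce / ch).
    rewrite mulf_neq0 ?invr_eq0//; apply/eqP => ce0; apply: e0 => x xI.
    by rewrite eE// ce0 mul0r.
  by move=> x xI; rewrite eE// hE// mulrA divfK.
have Pih f : BV f -> exists c, Pi f =I (fun x => c * h x).
  move=> bvf; have [c fc] := Pi1 f bvf; exists (c * kap) => x xI.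
  by rewrite fc// ekap// mulrA.
have Pi0 f : f =I (fun=> 0) -> Pi f =I (fun=> 0).
  move=> f0; have bvf : BV f by exact: bv_ext f0 _.
  have [c Pif] := Pih _ bvf.
  have : J (fun x => `|Pi f x|) <= 0.
    apply: le_trans (le_bv_norm (Pi f) a1) _; apply: le_trans (PiK f bvf) _.
    by rewrite (eq_on_bv_norm f0) bv_norm0// mulr0.
  rewrite (J_const_h Pif) normr_le0 => /eqP c0 x xI.
  by rewrite Pif// c0 mul0r.
have PiE f f' : BV f' -> f =I f' -> Pi f =I Pi f'.
  move=> bvf' ff'; have w0 : (fun x => f x - f' x) =I (fun=> 0).
    by move=> x xI; rewrite ff'// subrr.
  have bvw := bv_ext _ _ w0 bv0.
  have := Pilin 1 _ _ bvw bvf'.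
  rewrite (_ : (fun x => 1 * (f x - f' x) + f' x) = f); last first.
    by apply/funext => x; rewrite mul1r subrK.
  by move=> H x xI; rewrite H// (Pi0 _ w0)// mulr0 add0r.
have Pihh : Pi h =I h.
  have h1 : h =I (fun x => kap^-1 * e x + 0).
    by move=> x xI; rewrite ekap// addr0 mulKf.
  move=> x xI.
  have bv2 : BV (fun x => kap^-1 * e x + 0).
    by apply: bv_ext bv_h => y yI; rewrite -h1.
  rewrite (PiE _ _ bv2 h1)// (Pilin _ _ _ bve bv0)//.
  by rewrite (Pi0 (fun=> 0))// addr0 Pie// ekap// mulKf.
pose K' := `|C| * (V * (1 + fine (leb I))).
have K'0 : 0 <= K' by rewrite !mulr_ge0// addr_ge0// fine_ge0.
exists (V * K'), rho; split => //; first exact: mulr_ge0.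
move=> n f x gf f0.
have gi m : good (iter m L (L f)) by elim: m => [|m ih]; exact: gL.
have Ji m : J (iter m L (L f)) = 0.
  by elim: m => [|m ih]; rewrite /= JL.
have bvi m : BV (iter m L (L f)).
  by case: m => [|m] /=; exact: bvL.
have [k Pik] := Pih _ (bvi 0%N).
have Pikm m : Pi (iter m L (L f)) =I (fun x => k * h x).
  elim: m => // m ih y yI /=.
  by have [_ ->] := LPi _ (bvi m) => //; exact: ih.
pose S m := iter m (fun g => L g \- Pi g) (L f).
have gd m : good (fun x => - k * h x + iter m L (L f) x).
  by apply: bmD => //; exact: bmZ.
have SE m : S m.+1 =I (fun x => - k * h x + iter m.+1 L (L f) x).
  elim: m => [|m ih] y yI; first by rewrite /S/= Pik// mulNr addrC.
  have bvd : BV (fun x => - k * h x + iter m.+1 L (L f) x).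
    rewrite -[X in BV X](_ : L (fun x => - k * h x + iter m L (L f) x) = _).
      exact: bvL.
    by rewrite linL// stationary_fixed.
  rewrite /S iterS -/(S m.+1) /= (markov_eq_on ih) (PiE _ _ bvd ih)//.
  rewrite linL// (Pilin _ _ _ bv_h (bvi m.+1))// Pihh// Pikm//.
  by rewrite stationary_fixed mulNr addNr subr0.
have bvS m : J (fun x => `|S m x|) <= K' * rho ^+ m * J (fun y => `|f y|).
  apply: le_trans (le_bv_norm (S m) a1) _; apply: le_trans (dec m _ (bvi 0%N)) _.
  apply: (@le_trans _ _ (`|C| * rho ^+ m * bv_norm (- Gam) 1 (L f))).
    apply: ler_wpM2r; first exact: bv_norm_ge0.
    by apply: ler_wpM2r; [exact: exprn_ge0|exact: ler_norm].
  rewrite /K' [leRHS](_ : _ = `|C| * rho ^+ m *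
    (V * (1 + fine (leb I)) * J (fun y : R => `|f y|))); last by ring.
  apply: ler_wpM2l; first by rewrite mulr_ge0// exprn_ge0.
  exact: (markov_bv_norm HM gint s0 V0 HV).
have k0 : k = 0.
  apply/eqP; rewrite -normr_le0.
  have lim : (fun m => K' * rho ^+ m.+1 * J (fun y => `|f y|)) @ \oo --> (0 : R).
    rewrite [X in _ --> X](_ : _ = K' * 0 * J (fun y => `|f y|)); last first.
      by rewrite mulr0 mul0r.
    apply: cvgM; last exact: cvg_cst.
    apply: cvgM; first exact: cvg_cst.
    rewrite (cvg_shiftS (fun m => rho ^+ m)).
    by apply: cvg_expr; rewrite ger0_norm.
  apply: (cvgr_to_ge lim); apply: nearW => m; apply: le_trans (bvS m.+1).
  rewrite -normrN; have <- : J (fun x => - k * h x + iter m.+1 L (L f) x) = - k.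
    have ghk : good (fun x => - k * h x) by exact: bmZ.
    rewrite (@bm_intD _ (measurableTypeR R) R leb I mI finI _ _ ghk (gi m.+1)).
    rewrite Ji addr0 (@bm_intZ _ (measurableTypeR R) R leb I mI finI _ _ gh).
    by rewrite stationary_int mulr1.
  apply: le_trans (@bm_int_norm _ (measurableTypeR R) R leb I mI finI _ (gd m.+1)) _.
  rewrite le_eqVlt; apply/orP; left; apply/eqP; apply: eq_Rintegral => y.
  by rewrite inE => Iy; rewrite SE ?inE.
rewrite iterS iterSr; apply: le_trans (markov_le HM V0 HV _ (gi n)) _.
have -> : V * K' * rho ^+ n * J (fun y => `|f y|) =
    V * (K' * rho ^+ n * J (fun y => `|f y|)) by rewrite !mulrA.
apply: ler_wpM2l => //.
apply: le_trans (bvS n); rewrite le_eqVlt; apply/orP; left; apply/eqP.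
apply: eq_Rintegral => y; rewrite inE => Iy; case: (n) => // m.
by rewrite SE ?inE// k0 oppr0 mul0r add0r.
Qed.

End spectral_decay.

Section markov_mixing.
Context (R : realType) (M : noisy_map R).
Variables (mu : probability (measurableTypeR R) R) (h : R -> R).
Local Notation leb := (@lebesgue_measure R).
Hypothesis HM : assumption_TM M.
Hypothesis gint : (\int[leb]_y (noise_density M y)%:E = 1)%E.
Hypothesis SF : standing_facts M mu h.

Lemma amplitude_gt0 x : phase M x -> 0 < sigma M x.
Proof. exact: (sigma_gt0 HM gint (kernel_var SF)). Qed.

Lemma markov_mixing : exists V C rho : R, rho < 1 /\
  mixing_operator leb (phase M) (markov M) h V C rho.
Proof.
have s0 := amplitude_gt0.
have [V V0 HV] := kernel_variation_ae (kernel_var SF).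
have [C [rho [C0 rho0 rho1 dec]]] := spectral_decay HM gint s0 V0 HV SF.
exists V, C, rho; split => //; split.
- exact: (markov_bm HM gint s0 V0 HV).
- exact: (markov_linear HM V0 HV).
- move=> f x f0; apply: Rintegral_ge0 => y Iy.
  by rewrite mulr_ge0 ?f0// (trans_density_ge0 HM).
- by move=> f x gf; exact: (markov_le HM V0 HV).
- by move=> f gf; have [] := markov_fubini HM gint s0 V0 HV gf.
- exact: (stationary_bm HM V0 HV SF).
- exact: (h_ge0 SF).
- exact: (stationary_int SF).
- exact: (stationary_fixed HM SF).
- exact: V0.
- by [].
- exact: dec.
Qed.

End markov_mixing.

(** * The probability of a hit *)

Section hitting.
Context (R : realType) (M : noisy_map R) (s : R -> R).
Variables (psi : probability (measurableTypeR R) R) (B : set R).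
Hypotheses (ms : measurable_fun [set: R] s) (mB : measurable B).
Local Notation leb := (@lebesgue_measure R).

Let obs_set : set (R * measurableTypeR R) := [set xe | B (xe.1 + s xe.1 * xe.2)].

Let obs_meas : measurable obs_set.
Proof.
rewrite -[obs_set]setTI.
have mo : measurable_fun [set: R * measurableTypeR R] (fun xe => xe.1 + s xe.1 * xe.2).
  apply: measurable_funD => //; apply: measurable_funM => //.
  exact: (measurableT_comp ms measurable_fst).
exact: mo.
Qed.

Lemma obs_measurable x : @measurable _ (measurableTypeR R) [set e | B (x + s x * e)].
Proof.
have -> : [set e | B (x + s x * e)] = xsection obs_set x.
  by apply/seteqP; split => e; rewrite /xsection/= inE.
exact: measurable_xsection.
Qed.

Lemma hitE x : psi [set e | B (x + s x * e)] = (hit s psi B x)%:E.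
Proof. by rewrite /hit fineK// fin_num_measure//; exact: obs_measurable. Qed.

Lemma hit01 x : 0 <= hit s psi B x <= 1.
Proof.
rewrite -!lee_fin -hitE measure_ge0/=; apply: probability_le1.
exact: obs_measurable.
Qed.

Lemma hit_measurable : measurable_fun [set: R] (hit s psi B).
Proof.
have -> : hit s psi B = fine \o (psi \o xsection obs_set).
  apply/funext => x; congr (fine (psi _)).
  by apply/seteqP; split => e; rewrite /xsection/= inE.
by apply: measurableT_comp => //; exact: measurable_fun_xsection.
Qed.

Lemma missE x : \int[psi]_e (\1_(~` B) (x + s x * e)) = 1 - hit s psi B x.
Proof.
have mC : @measurable _ (measurableTypeR R) (~` [set e | B (x + s x * e)]).
  by apply: measurableC; exact: obs_measurable.
rewrite /Rintegral.
have -> : (\int[psi]_e (\1_(~` B) (x + s x * e)%R)%:E =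
    psi (~` [set e | B (x + s x * e)%R]))%E.
  transitivity (\int[psi]_e (\1_(~` [set e | B (x + s x * e)%R]) e)%:E)%E.
  by apply: eq_integral => e _; rewrite !indicE; congr EFin; congr (nat_of_bool _)%:R;
    apply/idP/idP; rewrite !inE.
  by rewrite integral_indic// setIT.
by rewrite probability_setC ?hitE//; exact: obs_measurable.
Qed.

Lemma markov_hatE : markov_hat M s psi B = killed (markov M) (hit s psi B).
Proof.
apply/funext => f; rewrite /markov_hat /killed; congr (markov M _).
by apply/funext => x; rewrite missE.
Qed.

Lemma hit_support (I : set R) (h : R -> R) c :
  (forall x, I x -> (exists2 e, msupport psi e & B (x + s x * e)) -> c <= h x) ->
  forall x, I x -> hit s psi B x * c <= hit s psi B x * h x.
Proof.
move=> ch x Ix; have /andP[k0 _] := hit01 x.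
have [->|kn0] := eqVneq (hit s psi B x) 0; first by rewrite !mul0r.
have hit0 : (0 < psi [set e | B (x + s x * e)%R])%E.
  by rewrite hitE lte_fin lt0r kn0.
apply: ler_wpM2l => //; apply: ch => //.
exact: (msupport_full (obs_measurable x) hit0).
Qed.

End hitting.

(** * The law of the surviving orbit *)

Section survival_law.
Context (R : realType) (M : noisy_map R).
Variables (mu : probability (measurableTypeR R) R) (h : R -> R).
Variables (s : R -> R) (psi : probability (measurableTypeR R) R) (B : set R).
Context (d : measure_display) (Omega : measurableType d) (P : probability Omega R).
Variables (X : {RV P >-> R}) (eta eps : nat -> {RV P >-> R}).
Local Notation leb := (@lebesgue_measure R).
Local Notation I := (phase M).
Local Notation p := (trans_density M).
Local Notation L := (markov M).
Local Notation k := (hit s psi B).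
Local Notation good := (@bounded_measurable _ (measurableTypeR R) R I).
Local Notation Y m w := (random_orbit M (fun i => eta i w) m (X w)).
Local Notation Z := (observed M s X eta eps).
Hypothesis HM : assumption_TM M.
Hypothesis SF : standing_facts M mu h.
Hypotheses (ms : measurable_fun [set: R] s) (mB : measurable B).
Hypothesis PL : product_law M X eta eps mu psi.

Lemma measurable_forall_lt (D : nat -> set Omega) N :
  (forall i, measurable (D i)) -> measurable [set w | forall i, (i < N)%N -> D i w].
Proof.
move=> mD; rewrite (_ : [set w | _] = \bigcap_(i in [set i | (i < N)%N]) D i)//.
by apply: bigcap_measurableType => i _; exact: mD.
Qed.

Lemma noise_law_eta E : measurable E -> P (eta 0%N @^-1` E) = noise_law M E.
Proof.
move=> mE; have := PL 1%N measurableT (fun=> mE) (fun=> measurableT).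
rewrite big_ord1 !probability_setT mul1e mule1 => <-; congr (P _).
apply/seteqP; split => w /=; first by move=> Ew; split => // -[].
by move=> [_ /(_ 0%N)] [].
Qed.

Lemma noise_density_int : (\int[leb]_y (noise_density M y)%:E = 1)%E.
Proof.
rewrite -/(noise_law M setT) -noise_law_eta//.
by rewrite preimage_setT probability_setT.
Qed.

Lemma orbit_measurable m : measurable_fun [set: Omega] (fun w => Y m w).
Proof.
elim: m => [|m ih] /=; first exact: measurable_funP.
apply: measurable_funD; first exact: (measurableT_comp (tmap_measurable HM) ih).
apply: measurable_funM; last exact: measurable_funP.
exact: (measurableT_comp (derivable_measurable (sigma_derivable HM)) ih).
Qed.

Lemma observed_measurable m : measurable_fun [set: Omega] (Z m).
Proof.
apply: measurable_funD; first exact: orbit_measurable.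
apply: measurable_funM; last exact: measurable_funP.
exact: (measurableT_comp ms (orbit_measurable m)).
Qed.

Definition no_hit m := [set w : Omega | forall j, (j < m)%N -> ~ B (Z j w)].

Lemma no_hitS m : no_hit m.+1 = no_hit m `&` [set w | ~ B (Z m w)].
Proof.
apply/seteqP; split => w /=.
  by move=> H; split => [j jm|]; apply: H => //; exact: ltnW.
by move=> [H Hm] j; rewrite ltnS leq_eqVlt => /predU1P[->//|]; exact: H.
Qed.

Let tail m N (E F : nat -> set R) := [set w : Omega | forall i, (i < N)%N ->
  E i (eta (m + i)%N w) /\ F i (eps (m + i)%N w)].

Let rv_measurable (W : {RV P >-> R}) E : measurable E -> measurable (W @^-1` E).
Proof. by move=> mE; rewrite -[_ @^-1` _]setTI; exact: measurable_funP. Qed.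

Lemma no_hit_measurable m : measurable (no_hit m).
Proof.
apply: (@measurable_forall_lt (fun j => [set w | ~ B (Z j w)])) => j.
have := observed_measurable j measurableT (measurableC mB).
by rewrite setTI.
Qed.

Let tail_measurable m N E F : (forall i, measurable (E i)) ->
  (forall i, measurable (F i)) -> measurable (tail m N E F).
Proof.
move=> mE mF.
apply: (@measurable_forall_lt (fun i =>
  eta (m + i)%N @^-1` E i `&` eps (m + i)%N @^-1` F i)).
by move=> i; apply: measurableI; exact: rv_measurable.
Qed.

Let scons (E0 : set R) (E : nat -> set R) i := if i is j.+1 then E j else E0.

Let scons_measurable E0 E : measurable E0 -> (forall i, measurable (E i)) ->
  forall i, measurable (scons E0 E i).
Proof. by move=> mE0 mE [|i]; [exact: mE0|exact: mE]. Qed.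

Let tail_scons m N E0 F0 E F : tail m N.+1 (scons E0 E) (scons F0 F) =
  eta m @^-1` E0 `&` eps m @^-1` F0 `&` tail m.+1 N E F.
Proof.
apply/seteqP; split => w /=.
  move=> H; split.
    by have := H 0%N; rewrite addn0; apply.
  by move=> i iN; have := H i.+1; rewrite addnS -addSn; apply.
move=> [H0 H] [|i] iN; first by rewrite addn0.
by rewrite addnS -addSn; exact: H.
Qed.

Let weight N (E F : nat -> set R) := (\prod_(i < N) (noise_law M (E i) * psi (F i)))%E.

Let weight_tail N E F : (forall i, measurable (E i)) ->
  (forall i, measurable (F i)) -> weight N E F = P (tail 0 N E F).
Proof.
move=> mE mF; have := PL N measurableT mE mF.
rewrite probability_setT mul1e -/(weight N E F) => <-; congr (P _).
by apply/seteqP; split => [w [_]//|w Hw]; split.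
Qed.

Let weight_fin N E F : (forall i, measurable (E i)) ->
  (forall i, measurable (F i)) -> weight N E F \is a fin_num.
Proof.
move=> mE mF; rewrite weight_tail// fin_num_measure//.
exact: tail_measurable.
Qed.

Let weight_ge0 N E F : (forall i, measurable (E i)) ->
  (forall i, measurable (F i)) -> (0 <= weight N E F)%E.
Proof. by move=> mE mF; rewrite weight_tail. Qed.

Lemma markov_tonelli (f : R -> R) A : measurable_fun [set: R] f ->
  (forall x, 0 <= f x) -> measurable A ->
  (forall z, (\int[leb]_(x in I) (f x * p x z)%:E \is a fin_num)%E) ->
  (\int[leb]_(z in A) (L f z)%:E =
   \int[leb]_(x in I) ((\int[leb]_(z in A) (p x z)%:E) * (f x)%:E))%E.
Proof.
move=> mf f0 mA fin.
pose G (xz : R * R) : \bar R := (\1_I xz.1 * \1_A xz.2 * (f xz.1 * p xz.1 xz.2))%:E.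
have mG : measurable_fun [set: R * R] G.
  have m1 : measurable_fun [set: R] (\1_I : R -> R).
    by apply: measurable_indic; exact: phase_measurable.
  have m2 : measurable_fun [set: R] (\1_A : R -> R) by exact: measurable_indic.
  apply/measurable_EFinP; apply: measurable_funM.
    apply: measurable_funM; first exact: (measurableT_comp m1 measurable_fst).
    exact: (measurableT_comp m2 measurable_snd).
  apply: measurable_funM; first exact: (measurableT_comp mf measurable_fst).
  exact: (trans_density_measurable HM).
have G0 xz : (0 <= G xz)%E.
  rewrite lee_fin; apply: mulr_ge0; first exact: mulr_ge0.
  by apply: mulr_ge0 => //; exact: (trans_density_ge0 HM).
have E := @fubini_tonelli _ _ (measurableTypeR R) (measurableTypeR R) R leb leb G mG G0.
rewrite [in RHS]integral_mkcond [in LHS]integral_mkcond.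
transitivity (\int[leb]_z \int[leb]_x G (x, z))%E.
  apply: eq_integral => z _; rewrite patchE /G/= indicE.
  case: (boolP (z \in A)) => [zA|_]; last first.
    by apply/esym/integral0_eq => x _; rewrite mulr0 mul0r.
  rewrite /markov /Rintegral (fineK (fin z)) [LHS]integral_mkcond.
  apply: eq_integral => x _.
  by rewrite patchE indicE; case: ifPn => _; rewrite ?mul1r ?mul0r.
rewrite -E; apply: eq_integral => x _; rewrite patchE /G/= indicE.
case: (boolP (x \in I)) => [xI|_]; last first.
  by apply: integral0_eq => z _; rewrite !mul0r.
have mpx : measurable_fun A (fun z => (p x z)%:E).
  apply/measurable_EFinP; apply: measurable_funTS.
  exact: (trans_density_measurable1 HM x).
have px0 z : A z -> (0 <= (p x z)%:E)%E by rewrite lee_fin (trans_density_ge0 HM).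
have fx0 : (0 <= (f x)%:E)%E by rewrite lee_fin.
have Zl := @ge0_integralZl _ (measurableTypeR R) R leb A mA _ mpx (f x)%:E px0 fx0.
rewrite muleC; refine (etrans _ Zl).
rewrite [RHS]integral_mkcond; apply: eq_integral => z _.
by rewrite patchE indicE; case: ifPn => _; rewrite ?mul1r ?mul0r ?mulr1 ?mulr0.
Qed.

Variables (V C rho : R).
Hypothesis mixL : mixing_operator leb I L h V C rho.

Let f_ m := iter m (killed L k) h.
Let mI : @measurable _ (measurableTypeR R) I := phase_measurable M.
Let finI : (leb I < +oo)%E := phase_finite M.

Let k_meas : measurable_fun [set: R] k := hit_measurable psi ms mB.
Let k01 := hit01 psi ms mB.

Let gf m : good (f_ m).
Proof. exact: (bm_iter_killed mixL k_meas k01 m (mix_fixed_bm mixL)). Qed.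

Let f0 m x : 0 <= f_ m x.
Proof. by apply: (iter_killed_ge0 mixL k01); exact: (mix_fixed_ge0 mixL). Qed.

Let f_out m x : ~ I x -> f_ m x = 0.
Proof.
case: m => [|m] nx; first exact: (stationary_density_out HM SF).
by rewrite /f_ /= /killed (markov_out HM).
Qed.

Let surv m x := f_ m x * (1 - k x).

Let gsurv m : good (surv m).
Proof.
apply: bmM => //; apply: bmB; first exact: bm_cst.
exact: (@bm_kill _ (measurableTypeR R) R I k k_meas k01).
Qed.

Let surv0 m x : 0 <= surv m x.
Proof. by rewrite mulr_ge0// subr_ge0; have /andP[] := k01 x. Qed.

Let good_lty (f : R -> R) : good f -> (forall x, 0 <= f x) ->
  (forall x, ~ I x -> f x = 0) -> (\int[leb]_x (f x)%:E < +oo)%E.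
Proof.
move=> gf' f'0 fout.
have [_] := integrableP _ _ _ (@bm_integrable _ (measurableTypeR R) R leb I mI finI f gf').
apply: le_lt_trans; rewrite [leRHS]integral_mkcond le_eqVlt; apply/orP; left; apply/eqP.
apply: eq_integral => x _; rewrite patchE; case: ifPn => [_|/negP nx].
  by rewrite gee0_abs// lee_fin.
by rewrite fout// => /mem_set.
Qed.

Let fA cr (A' : set R) (u : R -> R) : 0 <= cr -> (forall x, 0 <= u x) ->
  measurable_fun [set: R] u -> measurable A' ->
  (\int[leb]_(x in A') (cr * u x)%:E = \int[leb]_(x in A') (u x)%:E * cr%:E)%E.
Proof.
move=> cr0 u0 mu' mA'.
have mu1 : measurable_fun A' (fun x => (u x)%:E).
  by apply/measurable_EFinP; exact: measurable_funTS.
have u1 x : A' x -> (0 <= (u x)%:E)%E by rewrite lee_fin.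
have cr1 : (0 <= cr%:E)%E by rewrite lee_fin.
have Zl := @ge0_integralZl _ (measurableTypeR R) R leb A' mA' _ mu1 cr%:E u1 cr1.
by rewrite muleC; refine (etrans _ Zl).
Qed.

Section step.
Variable m : nat.
Hypothesis IH : forall N A E F, measurable A -> (forall i, measurable (E i)) ->
  (forall i, measurable (F i)) ->
  P (no_hit m `&` [set w | A (Y m w)] `&` tail m N E F) =
  (\int[leb]_(x in A) (f_ m x)%:E * weight N E F)%E.

(** Not being hit at time [m] involves the position and [eps m], which is
    independent of it; this multiplies the density by the survival probability
    [1 - k]. *)
Lemma observation_step N A E0 E F : measurable A -> measurable E0 ->
  (forall i, measurable (E i)) -> (forall i, measurable (F i)) ->
  P (no_hit m.+1 `&` [set w | A (Y m w)] `&` eta m @^-1` E0 `&` tail m.+1 N E F) =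
  (\int[leb]_(x in A) (surv m x)%:E * (noise_law M E0 * weight N E F))%E.
Proof.
move=> mA mE0 mE mF.
pose D := no_hit m `&` (eta m @^-1` E0 `&` tail m.+1 N E F).
have mD : measurable D.
  apply: measurableI; first exact: no_hit_measurable.
  by apply: measurableI; [exact: rv_measurable|exact: tail_measurable].
have cE : (noise_law M E0 * weight N E F = weight N.+1 (scons E0 E) (scons setT F))%E.
  by rewrite /weight big_ord_recl /= probability_setT mule1.
have mE1 := scons_measurable mE0 mE.
have mF1 := scons_measurable measurableT mF.
pose cr := fine (noise_law M E0 * weight N E F)%E.
have crE : cr%:E = (noise_law M E0 * weight N E F)%E.
  by rewrite /cr fineK// cE weight_fin.
have cr0 : 0 <= cr by rewrite -lee_fin crE cE weight_ge0.
have gg : good (fun x => cr * f_ m x) by exact: bmZ.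
pose S : set (measurableTypeR R * measurableTypeR R) :=
  [set xe | A xe.1 /\ ~ B (xe.1 + s xe.1 * xe.2)].
have mS : measurable S.
  have mo : measurable_fun [set: measurableTypeR R * measurableTypeR R]
      (fun xe : R * R => xe.1 + s xe.1 * xe.2).
    apply: measurable_funD => //; apply: measurable_funM => //.
    exact: (measurableT_comp ms measurable_fst).
  have m1 := @measurable_fst _ _ (measurableTypeR R) (measurableTypeR R) measurableT A mA.
  have m2 := mo measurableT _ (measurableC mB).
  by rewrite !setTI in m1 m2; exact: measurableI m1 m2.
have indep (A' F0 : set (measurableTypeR R)) : measurable A' -> measurable F0 ->
    mrestr P mD ((fun w => Y m w) @^-1` A' `&` eps m @^-1` F0) =
    (\int[leb]_(x in A') (cr * f_ m x)%:E * psi F0)%E.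
  move=> mA' mF0; rewrite fA//; last exact: (gf m).1.
  have := IH N.+1 mA' (scons_measurable mE0 mE) (scons_measurable mF0 mF).
  rewrite tail_scons /weight big_ord_recl /= -/(weight N E F).
  rewrite crE -!muleA [(weight N E F * psi F0)%E]muleC !muleA => <-.
  rewrite /mrestr; congr (P _); rewrite /D.
  by apply/seteqP; split => w /=; tauto.
have g0' x : 0 <= cr * f_ m x by exact: mulr_ge0.
have gfin : (\int[leb]_x (cr * f_ m x)%:E < +oo)%E.
  by apply: good_lty => // x nx; rewrite f_out// mulr0.
have H := @joint_law _ (measurableTypeR R) R leb (fun x => cr * f_ m x) gg.1 g0' gfin
  _ Omega _ (measurableTypeR R) (mrestr P mD) psi (fun w => Y m w) (eps m)
  (orbit_measurable m) (measurable_funP (eps m)) indep S mS.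
transitivity (mrestr P mD [set w | S (Y m w, eps m w)]).
  rewrite /mrestr; congr (P _); rewrite no_hitS /D /S /observed.
  by apply/seteqP; split => w /=; tauto.
refine (etrans H _); rewrite -crE -fA//; last exact: (gsurv m).1.
rewrite [RHS]integral_mkcond; apply: eq_integral => x _; rewrite patchE.
case: (boolP (x \in A)) => [/set_mem Ax|/negP nAx].
  rewrite (_ : [set y | S (x, y)] = ~` [set e | B (x + s x * e)]); last first.
    by apply/seteqP; split => e /=; [case|split].
  rewrite (probability_setC _ (obs_measurable ms mB x)) (hitE psi ms mB).
  by rewrite -EFinB -EFinM /surv; congr EFin; ring.
rewrite (_ : [set y | S (x, y)] = set0) ?measure0 ?mul0e//.
by apply/seteqP; split => e //= -[Ax _]; apply: nAx; exact: mem_set.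
Qed.

(** Moving on involves the position and [eta m], independent of it; this applies
    the Markov operator to the density. *)
Lemma dynamics_step N A E F : measurable A ->
  (forall i, measurable (E i)) -> (forall i, measurable (F i)) ->
  P (no_hit m.+1 `&` [set w | A (Y m.+1 w)] `&` tail m.+1 N E F) =
  (\int[leb]_(x in A) (f_ m.+1 x)%:E * weight N E F)%E.
Proof.
move=> mA mE mF.
pose D := no_hit m.+1 `&` tail m.+1 N E F.
have mD : measurable D.
  by apply: measurableI; [exact: no_hit_measurable|exact: tail_measurable].
pose cr := fine (weight N E F).
have crE : cr%:E = weight N E F by rewrite /cr fineK// weight_fin.
have cr0 : 0 <= cr by rewrite -lee_fin crE weight_ge0.
have gg : good (fun x => cr * surv m x) by exact: bmZ.
have g0' x : 0 <= cr * surv m x by exact: mulr_ge0.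
have gout x : ~ I x -> cr * surv m x = 0.
  by move=> nx; rewrite /surv f_out// mul0r mulr0.
have gfin : (\int[leb]_x (cr * surv m x)%:E < +oo)%E by exact: good_lty.
have indep (A' : set (measurableTypeR R)) (E0 : set R) :
    measurable A' -> measurable E0 ->
    mrestr P mD ((fun w => Y m w) @^-1` A' `&` eta m @^-1` E0) =
    (\int[leb]_(x in A') (cr * surv m x)%:E * distribution P (eta 0%N) E0)%E.
  move=> mA' mE0; rewrite fA//; last exact: (gsurv m).1.
  rewrite [distribution _ _ _]noise_law_eta// crE -muleA [(weight N E F * _)%E]muleC.
  rewrite -observation_step//.
  rewrite /mrestr; congr (P _); rewrite /D.
  by apply/seteqP; split => w /=; tauto.
pose S : set (measurableTypeR R * R) := [set xy | A (tmap_noisy M xy.2 xy.1)].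
have mS : measurable S.
  have mo : measurable_fun [set: measurableTypeR R * R] (fun xy => tmap_noisy M xy.2 xy.1).
    apply: measurable_funD.
      exact: (measurableT_comp (tmap_measurable HM) measurable_fst).
    apply: measurable_funM => //.
    exact: (measurableT_comp (derivable_measurable (sigma_derivable HM)) measurable_fst).
  by have := mo measurableT _ mA; rewrite setTI.
have H := @joint_law _ (measurableTypeR R) R leb (fun x => cr * surv m x) gg.1 g0' gfin
  _ Omega _ R (mrestr P mD) (distribution P (eta 0%N)) (fun w => Y m w) (eta m)
  (orbit_measurable m) (measurable_funP (eta m)) indep S mS.
transitivity (mrestr P mD [set w | S (Y m w, eta m w)]).
  rewrite /mrestr; congr (P _); rewrite /D /S.
  by apply/seteqP; split => w /=; tauto.
refine (etrans H _).
have sx := amplitude_gt0 HM noise_density_int SF.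
have [V' V0' HV'] := kernel_variation_ae (kernel_var SF).
have iu := @bm_integrable _ (measurableTypeR R) R leb I mI finI _ gg.
have fin z : (\int[leb]_(x in I) (cr * surv m x * p x z)%:E \is a fin_num)%E.
  have [iz _] := markov_integrable HM V0' HV' z gg.1 iu.
  exact: (@integrable_fin_num _ (measurableTypeR R) R leb I mI _ iz).
rewrite -crE -fA//; last exact: (gf m.+1).1.
have -> : (fun x => (cr * f_ m.+1 x)%:E) = (fun x => (L (fun y => cr * surv m y) x)%:E).
  by apply/funext => x; rewrite (mix_scale mixL cr (gsurv m)).
refine (etrans _ (esym (markov_tonelli gg.1 g0' mA fin))).
rewrite [RHS]integral_mkcond; apply: eq_integral => x _; rewrite patchE.
case: (boolP (x \in I)) => [/set_mem Ix|/negP nx]; last first.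
  by rewrite gout ?mule0// => /mem_set.
have mAx : measurable [set y | S (x, y)].
  have ma : measurable_fun [set: R] (fun y => tmap M x + sigma M x * y).
    by apply: measurable_funD => //; apply: measurable_funM.
  by have := ma measurableT _ mA; rewrite setTI.
congr (_ * _)%E; refine (etrans (noise_law_eta mAx) _).
exact: (noise_law_push HM sx Ix mA).
Qed.

End step.

(** The joint law of the noises is known on cylinders only. Carrying an
    arbitrary cylinder of the noises still to come through the induction states
    their independence of the past, so that each step is an application of
    [joint_law] to two variables. *)
Lemma survival_law m N A E F : measurable A -> (forall i, measurable (E i)) ->
  (forall i, measurable (F i)) ->
  P (no_hit m `&` [set w | A (Y m w)] `&` tail m N E F) =
  (\int[leb]_(x in A) (f_ m x)%:E * weight N E F)%E.
Proof.
elim: m N A E F => [|m IH] N A E F mA mE mF; last exact: dynamics_step.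
rewrite -(mu_density SF)//; have := PL N mA mE mF; rewrite -/(weight N E F) => <-.
congr (P _); apply/seteqP; split => w /=; first by move=> [[_ ?] ?]; split.
by move=> [? ?]; split => //; split => // j.
Qed.

Lemma no_hit_probability m : P (no_hit m) = (\int[leb]_(x in I) f_ m x)%:E.
Proof.
have mT (i : nat) : measurable [set: R] by [].
have := @survival_law m 0%N setT (fun=> setT) (fun=> setT) measurableT mT mT.
rewrite /weight big_ord0 mule1.
have -> : no_hit m `&` [set w | [set: R] (Y m w)] `&` tail m 0 (fun=> setT) (fun=> setT)
    = no_hit m.
  by apply/seteqP; split => w /=; [move=> [[]]|move=> Hw; split => // i].
move=> ->; rewrite /Rintegral fineK; last first.
  apply: (@integrable_fin_num _ (measurableTypeR R) R leb I mI).
  exact: (@bm_integrable _ (measurableTypeR R) R leb I mI finI _ (gf m)).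
rewrite [RHS]integral_mkcond; apply: eq_integral => x _; rewrite patchE.
by case: ifPn => // /negP nx; rewrite f_out// => /mem_set.
Qed.

End survival_law.

(** * The observed maximum *)

Section observed_maximum.
Context (R : realType) (M : noisy_map R).
Variables (mu : probability (measurableTypeR R) R) (h : R -> R).
Variables (s : R -> R) (psi : probability (measurableTypeR R) R).
Variables (phi : R -> \bar R) (u : nat -> R).
Context (d : measure_display) (Omega : measurableType d) (P : probability Omega R).
Variables (X : {RV P >-> R}) (eta eps : nat -> {RV P >-> R}).
Local Notation leb := (@lebesgue_measure R).
Local Notation I := (phase M).
Local Notation Gam := (Gamma M).
Local Notation Y m w := (random_orbit M (fun i => eta i w) m (X w)).
Local Notation Z := (observed M s X eta eps).
Local Notation B := (exceedance M phi u).
Hypothesis HM : assumption_TM M.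
Hypothesis SF : standing_facts M mu h.
Hypothesis OB : observational_noise M s psi.
Hypothesis PL : product_law M X eta eps mu psi.
Hypothesis mphi : measurable_fun [set: R] phi.

Lemma exceedance_measurable n : measurable (B n).
Proof.
apply: measurableI; first exact: phase_measurable.
have := emeasurable_fun_o_infty measurableT mphi (u n)%:E.
by rewrite setTI.
Qed.

Lemma observation_small x e : I x -> `[-1, 1]%classic e -> `|s x * e| < Gam / 2.
Proof.
move=> Ix Ie; apply: le_lt_trans (s_small OB).
apply: ub_le_sup; last by exists (x, e).
exists 1 => _ [[y f] [/= Iy If] <-].
have /phaseE /andP[_ s1] := s_phase OB Iy.
have s0 := s_gt0 OB Iy.
rewrite normrM gtr0_norm//; move: If; rewrite in_itv/= -ler_norml => f1.
by rewrite -[leRHS]mulr1; apply: ler_pM => //; exact: ltW.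
Qed.

Let typical n := [set w : Omega | `[- (Gam / 2), 1 - Gam / 2]%classic (X w) /\
  forall i, (i < n)%N -> `[- amp M, amp M]%classic (eta i w) /\
    `[-1, 1]%classic (eps i w)].

Let typical_prob n : P (typical n) = 1%E.
Proof.
have -> := PL n (measurable_itv _) (fun=> measurable_itv _) (fun=> measurable_itv _).
have -> : mu `[- (Gam / 2), 1 - Gam / 2]%classic = 1%E.
  rewrite (mu_density SF)//; have <- : (\int[leb]_x (h x)%:E = 1)%E.
    by rewrite -(mu_density SF)// probability_setT.
  rewrite integral_mkcond; apply: eq_integral => x _; rewrite patchE.
  case: ifPn => // /negP nx; rewrite (h_supp SF)//; apply/negP => xin; apply: nx.
  apply: mem_set; move: xin; rewrite /= !in_itv/= => /andP[h1 h2].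
  rewrite h2 andbT; apply: le_trans h1.
  have : I (1 - Gam / 2).
    by apply/phaseE; have := Gamma_gt0 HM; have := Gamma_le1 HM; lra.
  by move=> /(tmap_phase HM); have := Gamma_gt0 HM; lra.
have -> : noise_law M `[- amp M, amp M]%classic = 1%E.
  rewrite -(noise_density_int PL) /noise_law integral_mkcond.
  apply: eq_integral => x _; rewrite patchE; case: ifPn => // /negP nx.
  rewrite (noise_density_supp HM)// ltNge; apply/negP; rewrite ler_norml => xa.
  by apply: nx; apply: mem_set; rewrite /= in_itv.
by rewrite (psi_itv OB) mul1e big1// => i _; rewrite mule1.
Qed.

Let typical_orbit n w m : typical n w -> (m <= n)%N ->
  - (Gam / 2) <= Y m w <= 1 - Gam / 2.
Proof.
move=> [X0 H]; elim: m => [|m ih] mn /=; first by move: X0; rewrite /= in_itv.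
apply: (noisy_phase HM); first exact: (phase_half HM (ih (ltnW mn))).
by have [+ _] := H m mn; rewrite /= in_itv/= ler_norml.
Qed.

Let typical_observed n w m : typical n w -> (m < n)%N -> I (Z m w).
Proof.
move=> tw mn; have Ym := typical_orbit tw (ltnW mn).
have := observation_small (phase_half HM Ym) (tw.2 m mn).2.
rewrite ltr_norml => /andP[h1 h2]; apply/phaseE; rewrite /observed.
move: Ym => /andP[y1 y2]; have := Gamma_gt0 HM => G0.
by apply/andP; split; lra.
Qed.

(** The set [B n] only contains points of the phase space, so the two events
    can differ only when an observation leaves it; this almost surely never
    happens, because the noises are bounded and the initial point is away from the
    boundary. *)
Lemma max_below_probability n :
  P (max_below M s X eta eps phi u n) = P (no_hit M s (B n) X eta eps n).
Proof.
have mZ := observed_measurable X eta eps HM (s_measurable OB).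
have maxE : max_below M s X eta eps phi u n =
    [set w | forall j, (j < n)%N -> (phi (Z j w) <= (u n)%:E)%E].
  apply/seteqP; split => w.
    move=> /bigmax_leP[_ H] j jn; exact: (H (Ordinal jn)).
  by move=> H; apply/bigmax_leP; split => [|i _]; [exact: leNye|exact: H].
have mmax : measurable (max_below M s X eta eps phi u n).
  rewrite maxE; apply: (@measurable_forall_lt _ _ (fun j =>
    [set w | (phi (Z j w) <= (u n)%:E)%E])) => j.
  have := emeasurable_fun_infty_c measurableT (measurableT_comp mphi (mZ j)) (u n)%:E.
  by rewrite setTI.
have mno : measurable (no_hit M s (B n) X eta eps n).
  exact: (no_hit_measurable X eta eps HM (s_measurable OB) (exceedance_measurable n) n).
have mrv (W : {RV P >-> R}) E : measurable E -> measurable (W @^-1` E).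
  by move=> mE; rewrite -[_ @^-1` _]setTI; exact: measurable_funP.
have mty : measurable (typical n).
  apply: measurableI; first by apply: mrv; exact: measurable_itv.
  apply: (@measurable_forall_lt _ _ (fun i => eta i @^-1` `[- amp M, amp M]%classic `&`
    eps i @^-1` `[-1, 1]%classic)) => i.
  by apply: measurableI; apply: mrv; exact: measurable_itv.
have full A : measurable A -> P A = P (A `&` typical n).
  move=> mA; refine (etrans (measureDI P mA mty) _).
  rewrite -[RHS]add0e; congr (_ + _)%E.
  have ntyp : P (~` typical n) = 0%E.
    by rewrite probability_setC// typical_prob -EFinB subrr.
  apply/eqP; rewrite eq_le measure_ge0 andbT -[leRHS]ntyp.
  apply: le_measure; rewrite ?inE; [exact: measurableD|exact: measurableC|].
  by move=> w [].
rewrite full// [RHS]full//; congr (P _).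
rewrite maxE; apply/seteqP; split => w /= -[H tw]; split => // j jn.
  by move=> [_]; rewrite ltNge H.
rewrite leNgt; apply/negP => phiu; apply: (H j jn); split => //.
exact: typical_observed tw jn.
Qed.

End observed_maximum.

Theorem proposition5p1 (R : realType) (M : noisy_map R)
  (mu : probability (measurableTypeR R) R) (h : R -> R)
  (s : R -> R) (psi : probability (measurableTypeR R) R)
  (phi : R -> \bar R) (u : nat -> R) (tau : R)
  (d : measure_display) (Omega : measurableType d) (P : probability Omega R)
  (X : {RV P >-> R})
  (eta eps : nat -> {RV P >-> R}) :
  let B := exceedance M phi u in
  assumption_TM M ->
  standing_facts M mu h ->
  observational_noise M s psi ->
  product_law M X eta eps mu psi ->
  measurable_fun [set: R] phi ->
  (fun n => diameter (B n)) @ \oo --> (0 : R) ->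
  (exists2 c : R, 0 < c & forall (n : nat) (x : R), phase M x ->
     (exists2 e, msupport psi e & B n (x + s x * e)) -> c <= h x) ->
  (fun n => \int[lebesgue_measure]_(x in phase M) hit s psi (B n) x) @ \oo
    --> (0 : R) ->
  0 < tau ->
  (fun n => n%:R * Delta M s psi mu (B n)) @ \oo --> tau ->
  (forall k, cvgn (fun n => return_ratio M s psi mu h (B n) k)) ->
  let beta := extremal_index M s psi mu h B in
  0 < beta ->
  (fun n => fine (P (max_below M s X eta eps phi u n))) @ \oo
    --> expR (- (beta * tau)).
Proof.
move=> B HM SF OB PL mphi _ [c c0 ch] _ tau0 cvgtau cvgret beta beta0.
have mB n : measurable (B n) by exact: exceedance_measurable.
have ms := s_measurable OB.
have [V [C [rho [rho1 mixL]]]] := markov_mixing HM (noise_density_int PL) SF.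
pose mI : @measurable _ (measurableTypeR R) (phase M) := phase_measurable M.
pose finI := phase_finite M.
pose k n := hit s psi (B n).
have k_meas n : measurable_fun [set: R] (k n) := hit_measurable psi ms (mB n).
have k01 n := hit01 psi ms (mB n).
have kh n x : phase M x -> k n x * c <= k n x * h x.
  exact: (hit_support ms (mB n) (ch n)).
have DE n : Delta M s psi mu (B n) = kill_mass lebesgue_measure (phase M) h k n.
  rewrite /Delta /kill_mass /Rintegral; congr fine.
  rewrite integral_mkcond [RHS]integral_mkcond.
  have mk : measurable_fun [set: measurableTypeR R]
      ((fun x => (k n x)%:E) \_ (phase M)).
    apply/(measurable_restrictT _ mI)/measurable_EFinP.
    exact: (measurable_funS measurableT (@subsetT _ _) (k_meas n)).
  have k0 x : (0 <= ((fun x => (k n x)%:E) \_ (phase M)) x)%E.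
    rewrite patchE; case: ifPn => // _.
    by rewrite lee_fin; have /andP[] := k01 n x.
  refine (etrans (@ge0_integral_density _ (measurableTypeR R) R lebesgue_measure mu h
    (h_measurable SF) (h_ge0 SF) (mu_density SF) _ mk k0) _).
  apply: eq_integral => x _; rewrite !patchE.
  by case: ifPn => _; rewrite ?mul0e// -EFinM mulrC.
have diffE n f : @bounded_measurable _ (measurableTypeR R) R (phase M) f ->
    markov_diff M s psi (B n) f = markov M (fun x => f x * k n x).
  move=> gf; apply/funext => z; rewrite /markov_diff (markov_hatE M psi ms (mB n)).
  have := killed_split mixL (k_meas n) (k01 n) gf.
  by move=> /(congr1 (fun v => v z)) ->; rewrite addrAC subrr add0r.
have RE n j : return_ratio M s psi mu h (B n) j =
    return_mass lebesgue_measure (phase M) (markov M) h k n j /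
    kill_mass lebesgue_measure (phase M) h k n.
  have gD : @bounded_measurable _ (measurableTypeR R) R (phase M)
      (markov M (fun x => h x * k n x)).
    apply: (mix_bm mixL); apply: bmM; first exact: (mix_fixed_bm mixL).
    exact: (@bm_kill _ (measurableTypeR R) R (phase M) (k n) (k_meas n) (k01 n)).
  rewrite /return_ratio DE; congr (Rintegral _ _ _ / _).
  rewrite (diffE _ _ (mix_fixed_bm mixL)) (markov_hatE M psi ms (mB n)) diffE//.
  exact: (bm_iter_killed mixL (k_meas n) (k01 n)).
have cvgtau' : (fun n => n%:R * kill_mass lebesgue_measure (phase M) h k n) @ \oo --> tau.
  by under eq_fun do rewrite -DE.
have cvgret' j : cvgn (fun n => return_mass lebesgue_measure (phase M) (markov M) h k n j /
    kill_mass lebesgue_measure (phase M) h k n).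
  by rewrite -(funext (RE^~ j)); exact: cvgret.
have := @killed_exponential_law _ (measurableTypeR R) R lebesgue_measure (phase M) mI finI
  (markov M) h V C rho c tau k mixL rho1 k_meas k01 c0 kh tau0 cvgtau' cvgret'.
have qE : q_coef M s psi mu h B = (fun j => limn (fun n =>
    return_mass lebesgue_measure (phase M) (markov M) h k n j /
    kill_mass lebesgue_measure (phase M) h k n)).
  by apply/funext => j; rewrite /q_coef (funext (RE^~ j)).
rewrite -qE => /(_ beta0); apply: cvg_trans.
apply: near_eq_cvg; apply: nearW => n.
rewrite (max_below_probability u HM SF OB PL mphi).
by rewrite (no_hit_probability HM SF ms (mB n) PL mixL).
Qed.
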